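(* Let $\mathbb A\in\mathbb R^{N\times N}$ be a symmetric positive definite matrix with eigenvalues $0<\lambda_1\le\lambda_2\le\dots\le\lambda_N$, let $\alpha\in(0,1)$, let $k$ be a positive integer, and let $\mathbf f\in\mathbb R^N$, $\mathbf f\neq 0$. Put $\Lambda=\|\mathbb A\|_\infty=\max_{1\le i\le N}\sum_{j=1}^N|a_{ij}|$, $\mathcal A=\Lambda^{-1}\mathbb A$ and $\mu_1=\Lambda^{-1}\lambda_1$. Let $r_{1-\alpha}\in\mathcal R(k,k)$ be the best uniform rational approximation of $t^\alpha$ on $[0,1]$, and let $\xi_1$ be the smallest root in $(0,1)$ of $\varepsilon(t)=r_{1-\alpha}(t)-t^\alpha$. Let $\mathbf u=\mathbb A^{-\alpha}\mathbf f$ and $\mathbf u_r=\Lambda^{-\alpha}\,r_{1-\alpha}(\mathcal A)^{-1}\mathbf f$. If $\mu_1\in[0,\xi_1]$, then $$\frac{\|\mathbf u_r-\mathbf u\|_2}{\|\mathbf f\|_2}\le\lambda_1^{-\alpha}.$$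
   Context: $\|\cdot\|_2$ is the Euclidean norm. Functions of symmetric matrices (fractional powers $\mathbb A^{-\alpha}$ and rational functions $r(\mathcal A)$) are defined through the spectral decomposition; the spectrum of $\mathcal A$ lies in $(0,1]$. $\mathcal R(k,m)$ is the class of rational functions $r(t)=P_k(t)/Q_m(t)$ with real polynomials $P_k$ of degree at most $k$ and $Q_m$ of degree at most $m$, with $Q_m$ normalized to be monic. The best uniform rational approximation of $t^\alpha$ in $\mathcal R(k,k)$ is the minimizer $r_{1-\alpha}=\operatorname{argmin}_{r\in\mathcal R(k,k)}\|t^{\alpha}-r(t)\|_{L^\infty(0,1)}$ (the index convention is that $r_\beta$ approximates $t^{1-\beta}$). Known facts: $r_{1-\alpha}$ exists and is unique, its numerator and denominator have exact degree $k$, and the error function $\varepsilon$ has $2k+2$ extreme points in $[0,1]$ including both endpoints, and exactly $2k+1$ roots in $(0,1)$. The function $r_{1-\alpha}$ is positive on $[0,1]$, so $r_{1-\alpha}(\mathcal A)^{-1}$ is well defined. The vector $\mathbf u_r$ is called the $(k,k)$-R-BURA approximation of $\mathbf u$. *)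

(* Defs.v *)
From HB Require Import structures.
From mathcomp Require Import all_boot all_order all_algebra.
From mathcomp Require Import all_classical all_reals all_analysis.
Set Implicit Arguments.
Unset Strict Implicit.
Unset Printing Implicit Defensive.
Import Order.TTheory GRing.Theory Num.Theory.
Import numFieldNormedType.Exports.
Local Open Scope classical_set_scope.
Local Open Scope ring_scope.

Definition norm2 (R : realType) (N : nat) (v : 'cV[R]_N) : R :=
  Num.sqrt (\sum_(i < N) v i 0 ^+ 2).

Definition mx_norm_inf (R : realType) (N : nat) (A : 'M[R]_N) : R :=
  \big[Num.max/0]_(i < N) \sum_(j < N) `|A i j|.

Definition sym_posdef (R : realType) (N : nat) (A : 'M[R]_N) : Prop :=
  A^T = A /\ forall v : 'cV[R]_N, v != 0 -> 0 < (v^T *m A *m v) 0 0.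

(* lam lists the eigenvalues with their multiplicities, in nondecreasing
   order; lam`_0 is then the smallest one. *)
Definition ordered_spectrum (R : realType) (N : nat) (A : 'M[R]_N)
    (lam : N.-tuple R) : Prop :=
  sorted <=%R lam /\ char_poly A = \prod_(x <- lam) ('X - x%:P).

(* The rows of P are an orthonormal basis of eigenvectors of A. *)
Definition spectral_decomp (R : realType) (N : nat) (A P : 'M[R]_N)
    (d : 'rV[R]_N) : Prop :=
  P *m P^T = 1%:M /\ A = P^T *m diag_mx d *m P.

(* f(A) for a symmetric matrix A; the value does not depend on the
   decomposition selected by xget, see mxfunE. *)
Definition mxfun (R : realType) (N : nat) (f : R -> R) (A : 'M[R]_N) : 'M[R]_N :=
  xget 0 [set B | exists P d, spectral_decomp A P d /\
                    B = P^T *m diag_mx (map_mx f d) *m P].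

Lemma mxfunE (R : realType) (N : nat) (f : R -> R) (A P : 'M[R]_N)
    (d : 'rV[R]_N) :
  spectral_decomp A P d -> mxfun f A = P^T *m diag_mx (map_mx f d) *m P.
Proof.
move=> [PP AE]; rewrite /mxfun; case: xgetP => [B _ [Q [e [[QQ AE']] ->]]|]; last first.
  by move=> /(_ (P^T *m diag_mx (map_mx f d) *m P)) []; exists P, d.
have PP' : P^T *m P = 1%:M by apply: mulmx1C.
have QQ' : Q^T *m Q = 1%:M by apply: mulmx1C.
pose W := Q *m P^T.
have WE : diag_mx e *m W = W *m diag_mx d.
  have : Q *m A *m P^T = Q *m A *m P^T by [].
  rewrite {1}AE' AE !mulmxA QQ mul1mx -!mulmxA PP mulmx1 => ->.
  by rewrite /W !mulmxA.
have WfE : diag_mx (map_mx f e) *m W = W *m diag_mx (map_mx f d).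
  apply/matrixP => i j; move/matrixP/(_ i j): WE.
  rewrite !mul_diag_mx !mul_mx_diag !mxE; set w := \sum__ _.
  have [->|w0 H] := eqVneq w 0; first by rewrite !mulr0 !mul0r.
  suff -> : e 0 i = d 0 j by rewrite mulrC.
  by apply: (mulIf w0); rewrite H mulrC.
have -> : Q^T *m diag_mx (map_mx f e) *m Q =
          Q^T *m (diag_mx (map_mx f e) *m W) *m P.
  by rewrite /W -!mulmxA PP' mulmx1.
by rewrite WfE /W !mulmxA QQ' mul1mx.
Qed.

(* The class R(k, m), as functions on R. Division by zero yields 0, so the
   value at a zero of Q is a convention; such points form a finite set, which
   the norm in uniform_error does not see, and no zero of Q in [0, 1] survives
   in a best approximation. *)
Definition ratfun (R : realType) (k m : nat) : set (R -> R) :=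
  [set r | exists P Q : {poly R},
     [/\ (size P <= k.+1)%N, (size Q <= m.+1)%N, Q \is monic &
         r = (fun t => P.[t] / Q.[t])] ].

(* The norm of t^alpha - r(t) in L^oo(0, 1), the function being extended by 0
   outside of (0, 1). It is +oo when r has a pole in [0, 1]. *)
Definition uniform_error (R : realType) (alpha : R) (r : R -> R) : \bar R :=
  'N[@lebesgue_measure R]_+oo
    [ (fun t : R => (t `^ alpha - r t)%:E) \_ `]0, 1[ ].

(* r is the r_(1 - alpha) of the convention in which r_beta approximates
   t `^ (1 - beta). *)
Definition best_ratapprox (R : realType) (k : nat) (alpha : R) (r : R -> R)
    : Prop :=
  ratfun k k r /\
  forall s, ratfun k k s -> (uniform_error alpha r <= uniform_error alpha s)%E.

Definition smallest_root (R : realType) (e : R -> R) (xi : R) : Prop :=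
  [/\ 0 < xi < 1, e xi = 0 & forall t, 0 < t < 1 -> e t = 0 -> xi <= t].

(* Main.v *)
Require Import Defs.
From HB Require Import structures.
From mathcomp Require Import all_boot all_order all_algebra.
From mathcomp Require Import all_classical all_reals all_analysis.
From mathcomp Require Import ess_sup_inf.
From mathcomp Require Import lra ring zify.
Import Order.TTheory GRing.Theory Num.Theory.
Import numFieldNormedType.Exports.
Local Open Scope classical_set_scope.
Local Open Scope ring_scope.

(** Write r = P / Q and F(t) = P(t) - t^alpha Q(t), an exponential sum in ln t.

    Zeros of F: after cancelling the common factors of P and Q, let n be the
    larger of the two sizes. If F changed sign at fewer than k + n points,
    then the monic polynomial W with these roots would be of the form p Q - q P
    (Bezout), and (P - s p) / (Q - s q) would improve on r for small s with
    the right sign. Descartes' rule of signs allows at most 2 n - 1 zeros;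
    hence n = k + 1, there are exactly 2 k + 1 zeros, and all coefficients of
    P and Q are positive.

    Lower bound: t^alpha is a mixture of the functions t / (t + x) with x > 0,
    so that the divided difference of h(t)^2 t^alpha at 2 k + 2 points is
    nonnegative for every polynomial h of degree at most k. Take as points the
    zeros of F and a further point tau. Among the h with h(tau) = 1 the divided
    difference is minimal for h = Q / Q(tau), where it is a multiple of
    tau^alpha - r(tau); comparison with h = (t / tau)^m for a suitable m yields
    r(tau) >= xi1^alpha whenever r(tau) < tau^alpha.

    Hence r(mu) >= mu1^alpha for all mu >= mu1, so that 1 / r(mu) and
    mu^(-alpha) both lie in [0, mu1^(-alpha)]; the norm bound follows in an
    orthonormal basis of eigenvectors. *)

(** * Descartes' rule of signs *)

(** Rolle's theorem between consecutive zeros. That the new zeros stay to the right of [x] is what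
    lets the induction put the next one in front. *)
Lemma is_derive_seq_zeros {R : realType} (f df : R -> R) (x : R) (z : seq R) :
  (forall t : R, is_derive t 1 f (df t)) ->
  path <%R x z -> {in x :: z, forall t, f t = 0} ->
  exists z' : seq R, [/\ path <%R x z', size z' = size z &
    {in z', forall t, df t = 0}].
Proof.
move=> fdf; elim: z x => [|y z IH] x /=; first by exists [::].
case/andP=> xy pz f0.
have [|z' [pz' sz' dz']] := IH y pz.
  by move=> t tz; apply: f0; rewrite in_cons tz orbT.
have [t _|||c /itvP cxy fc0] := @Rolle R f x y xy.
- by have [] := fdf t.
- by apply: derivable_within_continuous => t _; have [] := fdf t.
- by rewrite !f0 // !in_cons eqxx ?orbT.
exists (c :: z'); split; last 1 first.
- move=> t; rewrite in_cons => /predU1P[->|/dz' //].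
  by have [_ <-] := fdf c; have [_ ->] := fc0.
- rewrite /= cxy /=; case: z' pz' {sz' dz'} => //= w z' /andP[yw ->].
  by rewrite (lt_trans _ yw) ?cxy.
- by rewrite /= sz'.
Qed.

(** Under t = exp s, a sum of real powers of t takes this form. Coefficients indexed by all of [nat]
    allow dropping the first or last term without casts. *)
Definition expsum {R : realType} (n : nat) (a b : nat -> R) (s : R) : R :=
  \sum_(i < n) a i * expR (b i * s).

Lemma is_derive_expsum {R : realType} n (a b : nat -> R) (s : R) :
  is_derive s 1 (expsum n a b) (expsum n (fun i => a i * b i) b s).
Proof.
have -> : expsum n a b = \sum_(i < n) (fun t => a i * expR (b i * t)).
  by apply/funext => t; rewrite fct_sumE.
apply: is_derive_sum => i.
have d1 : is_derive s 1 (fun t : R => b i * t) (b i).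
  have := @is_deriveZ _ _ _ (@id R) (b i) s 1 1 (is_derive_id _ _).
  by rewrite [X in is_derive _ _ _ X]mulr1.
have d2 := @is_derive1_comp _ expR _ s _ _ (is_derive_expR _) d1.
have := @is_deriveZ _ _ _ _ (a i) s 1 _ d2.
by rewrite [X in is_derive _ _ _ X]mulrCA mulrC -mulrA mulrCA mulrA.
Qed.

Lemma expsum_shift {R : realType} n (a b : nat -> R) (c s : R) :
  expsum n a (fun i => b i - c) s = expR (- (c * s)) * expsum n a b s.
Proof.
rewrite /expsum mulr_sumr; apply: eq_bigr => i _.
by rewrite mulrCA -expRD; congr (_ * expR _); ring.
Qed.

(** The factor exp(- c s) preserves zeros, and differentiation then multiplies the i-th coefficient
    by b_i - c; for c = b_i that term disappears. *)
Lemma expsum_shift_deriv_zeros {R : realType} n (a b : nat -> R) (c x : R) (z : seq R) :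
  path <%R x z -> {in x :: z, forall t, expsum n a b t = 0} ->
  exists z' : seq R, [/\ path <%R x z', size z' = size z &
    {in z', forall t,
      expsum n (fun i => a i * (b i - c)) (fun i => b i - c) t = 0}].
Proof.
move=> pz z0.
apply: (@is_derive_seq_zeros R (expsum n a (fun i => b i - c))) => //.
  by move=> t; exact: is_derive_expsum.
by move=> t /z0; rewrite expsum_shift => ->; rewrite mulr0.
Qed.

(* Descartes' rule of signs in its extremal case. Discarding the lowest term,
   or the highest one, by a differentiation costs one zero. *)
Lemma expsum_alternate {R : realType} n (a b : nat -> R) (z : seq R) :
  {homo b : i j / (i < j)%N >-> i < j} ->
  (exists2 i, (i <= n)%N & a i != 0) ->
  sorted <%R z -> {in z, forall t, expsum n.+1 a b t = 0} -> (n <= size z)%N ->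
  size z = n /\ forall i, (i < n)%N -> a i * a i.+1 < 0.
Proof.
elim: n a b z => [|n IH] a b z hb [i0 i0n ai0].
  case: z => // x z _ z0 _; exfalso.
  have /eqP := z0 x (mem_head _ _); rewrite /expsum big_ord1 mulf_eq0.
  by move: i0n ai0; rewrite leqn0 => /eqP -> /negbTE -> /=; rewrite gt_eqF ?expR_gt0.
case: z => [//|x z] pz z0 nz.
(* Drop the lowest term: the factors b_(i+1) - b_0 are positive, so products of neighbouring
   coefficients keep their signs. *)
have [z' [pz' sz' dz']] := @expsum_shift_deriv_zeros R _ _ _ (b 0%N) _ _ pz z0.
have dz0 : {in z', forall t, expsum n.+1 (fun i => a i.+1 * (b i.+1 - b 0%N))
    (fun i => b i.+1 - b 0%N) t = 0}.
  move=> t /dz'; rewrite {1}/expsum big_ord_recl subrr mulr0 mul0r add0r => <-.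
  by apply: eq_bigr.
have b0 i : 0 < b i.+1 - b 0%N by rewrite subr_gt0; apply: hb.
have [i1 i1n ai1] : exists2 i, (i <= n)%N & a i.+1 != 0.
  apply: contrapT => /forall2NP H.
  have a0 i : (i <= n)%N -> a i.+1 = 0.
    by move=> ni; case: (H i) => // /negP; rewrite negbK => /eqP.
  case: i0 i0n ai0 => [_|i0 i0n]; last by rewrite a0 ?eqxx.
  have := z0 x (mem_head _ _).
  rewrite /expsum big_ord_recl big1 => [|i _]; last first.
    by rewrite lift0 a0 ?mul0r // -ltnS.
  by move/eqP; rewrite addr0 mulf_eq0 (gt_eqF (expR_gt0 _)) orbF => ->.
have [|||szE alt] := IH _ _ z' _ _ (path_sorted pz') dz0.
- by move=> i j ij; rewrite ltrD2r hb.
- by exists i1 => //; rewrite mulf_neq0 // gt_eqF.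
- by rewrite sz' -ltnS.
have alt1 i : (i < n)%N -> a i.+1 * a i.+2 < 0.
  move=> /alt; rewrite mulrACA => h.
  by rewrite -(pmulr_llt0 _ (mulr_gt0 (b0 i) (b0 i.+1))).
split; first by rewrite /= -sz' szE.
case=> [_|i]; last by rewrite ltnS; exact: alt1.
(* The pair a_0, a_1 remains. With two terms its signs are read off from a zero; otherwise the
   highest term is dropped instead, and the negative factors b_i - b_(n+2) cancel in pairs. *)
case: n IH {alt} pz z0 nz sz' szE i0n i1n dz' dz0 alt1 => [|n] IH pz z0 nz sz' szE i0n i1n dz' dz0 alt1.
  have := z0 x (mem_head _ _); rewrite /expsum big_ord_recl big_ord1 /=.
  move: i1n ai1; rewrite leqn0 => /eqP -> a1.
  have e0 := expR_gt0 (b 0%N * x); have e1 := expR_gt0 (b 1%N * x).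
  rewrite /bump /= addn0 => E.
  rewrite -(pmulr_llt0 _ e0) mulrAC.
  have -> : a 0%N * expR (b 0%N * x) = - (a 1%N * expR (b 1%N * x)).
    by apply/eqP; rewrite -subr_eq0 opprK E.
  by rewrite mulNr mulrAC -expr2 oppr_lt0 mulr_gt0 // exprn_even_gt0.
have [y' [py' sy' dy']] := @expsum_shift_deriv_zeros R _ _ _ (b n.+2) _ _ pz z0.
have dy0 : {in y', forall t, expsum n.+2 (fun i => a i * (b i - b n.+2))
    (fun i => b i - b n.+2) t = 0}.
  move=> t /dy'; rewrite {1}/expsum big_ord_recr /= subrr mulr0 mul0r addr0 => <-.
  by apply: eq_bigr.
have bn i : (i < n.+2)%N -> b i - b n.+2 < 0 by move=> ?; rewrite subr_lt0 hb.
have [|||_ alt] := IH _ _ y' _ _ (path_sorted py') dy0.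
- by move=> i j ij; rewrite ltrD2r hb.
- exists 1%N => //; apply: mulf_neq0; last by rewrite lt_eqF ?bn.
  by apply/negP => /eqP a1; have := alt1 0%N isT; rewrite a1 mul0r ltxx.
- by rewrite sy' -ltnS.
have := alt 0%N isT; rewrite mulrACA pmulr_llt0 //.
by rewrite nmulr_rgt0 ?bn.
Qed.

(** * Zeros of P(t) - t^alpha Q(t) *)

Lemma big_ord_double {V : nmodType} n (G : nat -> V) :
  \sum_(i < n.*2) G i = \sum_(i < n) (G i.*2 + G i.*2.+1).
Proof.
elim: n => [|n IH]; first by rewrite !big_ord0.
by rewrite doubleS !big_ord_recr /= IH addrA.
Qed.

(** Index 2 i carries P_i with exponent i, and index 2 i + 1 carries - Q_i with exponent i + alpha;
    for 0 < alpha < 1 these exponents increase. *)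
Lemma expsum_horner {R : realType} (P Q : {poly R}) (alpha s : R) n :
  (size P <= n)%N -> (size Q <= n)%N ->
  expsum n.*2 (fun i => if odd i then - Q`_i./2 else P`_i./2)
    (fun i => i./2%:R + (odd i)%:R * alpha) s =
  P.[expR s] - expR s `^ alpha * Q.[expR s].
Proof.
move=> sP sQ; rewrite /expsum (big_ord_double n (fun i =>
  (if odd i then - Q`_i./2 else P`_i./2) * expR ((i./2%:R + (odd i)%:R * alpha) * s))).
rewrite (horner_coef_wide _ sP) (horner_coef_wide _ sQ) mulr_sumr -sumrB.
apply: eq_bigr => i _ /=.
rewrite odd_double /= doubleK uphalf_double mul0r addr0 mul1r.
rewrite /powR (gt_eqF (expR_gt0 _)) expRK mulrDl expRD -!expRM_natl.
by ring.
Qed.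

(** There are 2 m + 2 terms, hence at most 2 m + 1 positive zeros; with that many, P_0, - Q_0, P_1,
    - Q_1, ... alternates in sign. *)
Lemma poly_powR_alternate {R : realType} (P Q : {poly R}) (alpha : R) m (z : seq R) :
  0 < alpha < 1 -> (size P <= m.+1)%N -> (size Q <= m.+1)%N ->
  (P != 0) || (Q != 0) -> uniq z ->
  {in z, forall t, 0 < t /\ P.[t] = t `^ alpha * Q.[t]} ->
  (m.*2.+1 <= size z)%N ->
  [/\ size z = m.*2.+1, forall i, (i <= m)%N -> 0 < P`_i * Q`_i &
      forall i, (i < m)%N -> 0 < Q`_i * P`_i.+1].
Proof.
move=> /andP[a0 a1] sP sQ PQ uz z0 sz.
pose s := sort <=%R (map (@ln R) z).
have sE : size s = size z by rewrite size_sort size_map.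
have us : sorted <%R s.
  rewrite lt_sorted_uniq_le sort_uniq sort_le_sorted andbT map_inj_in_uniq //.
  by move=> x y /z0[x0 _] /z0[y0 _]; apply: ln_inj.
have s0 : {in s, forall t, expsum m.*2.+1.+1
    (fun i => if odd i then - Q`_i./2 else P`_i./2)
    (fun i => i./2%:R + (odd i)%:R * alpha) t = 0}.
  move=> t; rewrite mem_sort => /mapP[x /z0[x0 Ex] ->].
  by rewrite -doubleS expsum_horner // lnK ?posrE // Ex subrr.
have [|||szE alt] := @expsum_alternate R _ _ _ s _ _ us s0.
- apply: homo_ltn => [x y w|i]; first exact: lt_trans.
  rewrite /= uphalf_half natrD.
  by case: (odd i); rewrite /= ?mul1r ?mul0r; move: a0 a1; lra.
- case/orP: PQ => h; [exists (size P).-1.*2|exists (size Q).-1.*2.+1].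
  + by rewrite leqW // leq_double -ltnS prednK ?size_poly_gt0.
  + by rewrite odd_double doubleK -lead_coefE lead_coef_eq0.
  + by rewrite ltnS leq_double -ltnS prednK ?size_poly_gt0.
  + by rewrite /= odd_double /= uphalf_double oppr_eq0 -lead_coefE lead_coef_eq0.
- by rewrite sE.
split; first by rewrite -sE.
- move=> i im; have := alt i.*2; rewrite /= odd_double /= doubleK uphalf_double.
  by rewrite mulrN oppr_lt0; apply; rewrite ltnS leq_double.
- move=> i im; have := alt i.*2.+1; rewrite /= odd_double /= doubleK uphalf_double.
  by rewrite mulNr oppr_lt0; apply; rewrite ltnS ltn_double.
Qed.

(** * Best rational approximation *)

Lemma lebesgue_measureT_gt0 {R : realType} : (0 < @lebesgue_measure R setT)%E.
Proof.
apply: (@lt_le_trans _ _ (lebesgue_measure (`[0, 1]%classic : set R))).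
  by rewrite lebesgue_measure_itv /= lte_fin ltr01 oppr0 adde0 lte_fin.
by apply: le_measure; rewrite ?inE//; exact: measurable_itv.
Qed.

(** For [0 <= e] the extension by 0 never exceeds the bound, which leaves only the points of ]0,
    1[. *)
Lemma uniform_error_leP {R : realType} (alpha : R) (r : R -> R) (e : R) :
  0 <= e ->
  (uniform_error alpha r <= e%:E)%E <->
  (@lebesgue_measure R).-negligible
    [set t | 0 < t < 1 /\ e < `|t `^ alpha - r t|].
Proof.
move=> e0; rewrite /uniform_error unlock /= lebesgue_measureT_gt0.
split.
- move/ess_supP; apply: negligibleS => t /= [t01 et] H; move: et.
  by rewrite ltNge -lee_fin; move: H; rewrite patchE mem_set /= ?in_itv //= => ->.
- move=> H; apply/ess_supP; move: H; apply: negligibleS => t /= /negP; rewrite -ltNge.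
  rewrite patchE; case: ifPn => [|_]; last by rewrite /= normr0 lte_fin ltNge e0.
  by rewrite inE /= in_itv /= lte_fin.
Qed.

(** A strict violation at one point of [0, 1], even an endpoint, persists on a nonempty open
    interval inside ]0, 1[, which has positive measure. *)
Lemma ae_le_continuous {R : realType} (f g : R -> R) :
  continuous f -> continuous g ->
  (@lebesgue_measure R).-negligible [set t | 0 < t < 1 /\ g t < f t] ->
  forall t, 0 <= t <= 1 -> f t <= g t.
Proof.
move=> cf cg [N [mN N0 subN]] x /andP[x0 x1]; rewrite leNgt; apply/negP => fgx.
have : \forall t \near x, 0 < f t - g t.
  have cfg : (f t - g t) @[t --> x] --> f x - g x by apply: cvgB; [exact: cf|exact: cg].
  by apply: (cvgr_gt _ cfg); rewrite subr_gt0.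
move=> /nbhs_ballP[d /= d0 Hd].
pose a := Num.max 0 (x - d); pose b := Num.min 1 (x + d).
have ab : a < b.
  by rewrite /a /b gt_max !lt_min; apply/andP; split; apply/andP; split; lra.
have : (lebesgue_measure `]a, b[%classic <= lebesgue_measure N)%E.
  apply: le_measure; rewrite ?inE //.
  move=> t /=; rewrite in_itv /= /a /b gt_max lt_min => /andP[/andP[t0 t1] /andP[t2 t3]].
  apply: subN => /=; split; first by rewrite t0.
  rewrite -subr_gt0; apply: Hd; rewrite /ball /= ltr_norml; apply/andP; split; lra.
rewrite N0 lebesgue_measure_itv /= lte_fin ab -EFinB lee_fin.
by rewrite leNgt subr_gt0 ab.
Qed.

(** The absolute value gives a function continuous on the whole line that agrees with t^alpha on
    [0, 1], so that later lemmas can assume global continuity. *)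
Lemma continuous_normr_powR {R : realType} (alpha : R) :
  0 < alpha -> continuous (fun t : R => `|t| `^ alpha).
Proof.
move=> a0 x; have [->|x0] := eqVneq x 0.
  rewrite /continuous_at normr0 powR0 ?gt_eqF //.
  apply/cvgr0Pnorm_lt => e e0; near=> t.
  rewrite ger0_norm ?powR_ge0 //.
  have -> : e = (e `^ alpha^-1) `^ alpha.
    by rewrite -powRrM mulVf ?gt_eqF // powRr1 // ltW.
  rewrite gt0_ltr_powR ?nnegrE ?powR_ge0 //.
  near: t; apply/nbhs_ballP; exists (e `^ alpha^-1) => /=; first exact: powR_gt0.
  by move=> t; rewrite /ball /= sub0r normrN.
apply: (@continuous_comp _ _ _ (fun t : R => `|t|) (fun t : R => t `^ alpha)).
  exact: norm_continuous.
apply/differentiable_continuous/derivable1_diffP/derivable_powR.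
by rewrite in_itv /= andbT normr_gt0.
Unshelve. all: by end_near. Qed.

(** Descartes' rule bounds the length of a list of distinct zeros; a longest one contains them
    all. *)
Lemma poly_powR_zeros {R : realType} (P Q : {poly R}) (alpha : R) :
  0 < alpha < 1 -> (P != 0) || (Q != 0) ->
  exists2 z : seq R, uniq z &
    forall t, (t \in z) <-> 0 < t < 1 /\ P.[t] = t `^ alpha * Q.[t].
Proof.
move=> a01 PQ; pose m := maxn (size P) (size Q).
have sP : (size P <= m.+1)%N by rewrite leqW // leq_maxl.
have sQ : (size Q <= m.+1)%N by rewrite leqW // leq_maxr.
pose zeros (z : seq R) :=
  uniq z /\ {in z, forall t, 0 < t < 1 /\ P.[t] = t `^ alpha * Q.[t]}.
have exz : exists n, `[< exists2 z, zeros z & size z = n >].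
  by exists 0%N; apply/asboolP; exists [::].
have ubz n : `[< exists2 z, zeros z & size z = n >] -> (n <= m.*2.+1)%N.
  move=> /asboolP[z [uz z0] <-]; rewrite leqNgt; apply/negP => h.
  have [||szE _ _] := poly_powR_alternate P Q alpha m z a01 sP sQ PQ uz.
  - by move=> t /z0[/andP[-> _]].
  - exact: ltnW.
  - by rewrite szE ltnn in h.
have [n /asboolP[z [uz z0] sz] maxz] := ex_maxnP exz ubz.
exists z => // t; split; first exact: z0.
move=> t0; apply/negPn/negP => tz.
suff : (n.+1 <= n)%N by rewrite ltnn.
apply/maxz/asboolP; exists (t :: z); last by rewrite /= sz.
split; first by rewrite /= tz.
by move=> u; rewrite in_cons => /predU1P[->|/z0].
Qed.

Lemma ltr_sign_change_zero {R : realType} (f : R -> R) (a b : R) :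
  continuous f -> f a * f b < 0 ->
  exists2 c, Num.min a b < c < Num.max a b & f c = 0.
Proof.
move=> cf; wlog ab : a b / a <= b.
  move=> H; case: (leP a b) => [ab|/ltW ba] h.
    by have := H a b ab h; rewrite min_l ?max_r.
  by have := H b a ba; rewrite mulrC min_l ?max_r //; apply.
move=> h; rewrite min_l ?max_r //.
have [||c] := @IVT R f a b 0 ab.
- exact: continuous_subspaceT.
- rewrite ge_min le_max; move: h; case: (ltgtP (f a) 0) => fa; nra.
- rewrite in_itv /= => /andP[ac cb] fc; exists c => //.
  rewrite !lt_neqAle ac cb !andbT; apply/andP; split; apply/eqP => E.
  + by move: h; rewrite E fc mul0r ltxx.
  + by move: h; rewrite -E fc mulr0 ltxx.
Qed.

Lemma constant_sign {R : realType} (f : R -> R) (a b : R) :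
  a < b -> continuous f -> (forall t, a < t < b -> f t != 0) ->
  exists s : bool, forall t, a < t < b -> 0 < (-1) ^+ s * f t.
Proof.
move=> ab cf f0; pose m := (a + b) / 2.
have mab : a < m < b by apply/andP; split; rewrite /m; lra.
exists (f m < 0) => t tab.
have := f0 _ tab; have := f0 _ mab; have := ltr_sign_change_zero f m t cf.
case: (ltgtP (f m) 0) => // fm H _; case: (ltgtP (f t) 0) => //= ft _;
  rewrite ?expr1 ?expr0 ?mul1r ?mulN1r ?oppr_gt0 //.
- have [|c] := H; first by nra.
  rewrite gt_min lt_max => /andP[h1 h2] /eqP; rewrite (negbTE (f0 c _)) //.
  by move: mab tab h1 h2 => /andP[? ?] /andP[? ?] /orP[] ? /orP[] ?; apply/andP; split; lra.
- have [|c] := H; first by nra.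
  rewrite gt_min lt_max => /andP[h1 h2] /eqP; rewrite (negbTE (f0 c _)) //.
  by move: mab tab h1 h2 => /andP[? ?] /andP[? ?] /orP[] ? /orP[] ?; apply/andP; split; lra.
Qed.

Lemma signr_prod_subl {R : realFieldType} (t : R) (s : seq R) :
  {in s, forall x, t < x} -> 0 < (-1) ^+ size s * \prod_(x <- s) (t - x).
Proof.
elim: s => [|x s IH] h; first by rewrite big_nil mul1r ltr01.
rewrite big_cons /= exprS mulrACA mulN1r opprB mulr_gt0 //.
  by rewrite subr_gt0 h // mem_head.
by apply: IH => y ys; apply: h; rewrite in_cons ys orbT.
Qed.

Lemma sign_change_polynomial {R : realType} (f : R -> R) (a b : R) (z : seq R) :
  continuous f -> path <%R a z -> a < b ->
  (forall t, (t \in z) <-> a < t < b /\ f t = 0) ->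
  exists (s : seq R) (e : bool), [/\ uniq s, {subset s <= z} &
    forall t, a < t < b -> 0 <= (-1) ^+ e * (f t * \prod_(x <- s) (t - x))].
Proof.
move=> cf; elim: z a => [|c z IH] a pz ab z0.
  have [t tab|e He] := constant_sign f a b ab cf.
    by apply/eqP => ft; have /z0 : a < t < b /\ f t = 0 by [].
  by exists [::], e; split=> // t /He/ltW; rewrite big_nil mulr1.
move: pz => /= /andP[ac pz].
have [/andP[_ cb] fc] : a < c < b /\ f c = 0 by apply/z0; rewrite mem_head.
have zc x : x \in z -> c < x by move: pz; rewrite lt_path_sortedE => /andP[/allP h _] /h.
have [t|s [e [us sz He]]] := IH c pz cb.
  split=> [tz|[/andP[ct tb] ft]].
    have [/andP[_ tb] ft] : a < t < b /\ f t = 0 by apply/z0; rewrite in_cons tz orbT.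
    by rewrite zc.
  have /z0 : a < t < b /\ f t = 0 by rewrite tb (lt_trans ac ct).
  by rewrite in_cons => /predU1P[tc|//]; rewrite tc ltxx in ct.
have [t /andP[ta tc]|d Hd] := constant_sign f a c ac cf.
  apply/eqP => ft; have /z0 : a < t < b /\ f t = 0 by rewrite ta (lt_trans tc cb).
  rewrite in_cons => /predU1P[E|/zc]; first by rewrite E ltxx in tc.
  by move/(lt_trans tc); rewrite ltxx.
have sgl t : t < c -> 0 < (-1) ^+ size s * \prod_(x <- s) (t - x).
  by move=> tc; apply: signr_prod_subl => x /sz/zc; exact: lt_trans.
(* The product over [s] keeps its sign at [c]. If its product with f has the same sign on both sides
   of [c], then f does not change sign there; otherwise [c] is added as a root. *)
have [E|E] := eqVneq (odd (d + size s)) e.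
  exists s, e; split=> // [x /sz xz|t /andP[ta tb]]; first by rewrite in_cons xz orbT.
  case: (ltgtP t c) => [tc|ct|->]; last by rewrite fc mul0r mulr0.
  - rewrite -E signr_odd exprD mulrACA ltW // mulr_gt0 ?sgl //.
    by apply: Hd; rewrite ta.
  - by apply: He; rewrite ct.
exists (c :: s), e; split.
- by rewrite /= us andbT; apply/negP => /sz/zc; rewrite ltxx.
- move=> x; rewrite !in_cons => /predU1P[->|/sz ->]; first by rewrite eqxx.
  by rewrite orbT.
move=> t /andP[ta tb]; rewrite big_cons.
case: (ltgtP t c) => [tc|ct|->]; last by rewrite fc mul0r mulr0.
- have -> : (-1) ^+ e = - (-1) ^+ (d + size s) :> R.
    rewrite -[in RHS]signr_odd; move: E.
    by case: (odd _); case: (e); rewrite /= ?expr1 ?expr0 ?opprK.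
  have -> : - (-1) ^+ (d + size s) * (f t * ((t - c) * \prod_(x <- s) (t - x))) =
    (c - t) * (((-1) ^+ d * f t) * ((-1) ^+ size s * \prod_(x <- s) (t - x))).
    by rewrite exprD; ring.
  by rewrite ltW // mulr_gt0 ?subr_gt0 // mulr_gt0 ?sgl // Hd ?ta.
- rewrite (mulrCA (f t)) (mulrCA (_ ^+ e)) mulr_ge0 ?subr_ge0 ?(ltW ct) //.
  by apply: He; rewrite ct.
Qed.

(** Multiply a Bezout identity by W and reduce the coefficient of P modulo Q; comparing sizes in b Q
    = W - a P then bounds b. *)
Lemma coprimep_combination {F : fieldType} (P Q W : {poly F}) k :
  coprimep P Q -> (size P <= size Q)%N -> (size Q <= k.+1)%N ->
  (size W <= k + size Q)%N ->
  exists a b : {poly F}, [/\ (size a <= k.+1)%N, (size b <= k.+1)%N &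
    W = a * P + b * Q].
Proof.
move=> cPQ sPQ sQ sW.
have Q0 : Q != 0.
  apply/eqP => Q0; move: sPQ; rewrite Q0 size_poly0 leqn0 size_poly_eq0 => /eqP P0.
  by move: cPQ; rewrite P0 Q0 coprimep0 -size_poly_eq1 size_poly0.
have [[u v] /= uv] := Bezout_eq1_coprimepP _ _ cPQ.
pose a := (W * u) %% Q; pose b := ((W * u) %/ Q) * P + W * v.
have WE : W = a * P + b * Q.
  rewrite -[LHS]mulr1 -uv mulrDr !mulrA.
  rewrite {1}(divp_eq (W * u) Q) /a /b; ring.
have sa : (size a < size Q)%N by rewrite ltn_modp.
exists a, b; split=> //; first exact: leq_trans (ltnW sa) sQ.
have [->|b0] := eqVneq b 0; first by rewrite size_poly0.
have : (size (b * Q)%R <= k + size Q)%N.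
  have -> : b * Q = W - a * P by rewrite WE addrAC subrr add0r.
  apply: leq_trans (size_polyD _ _) _; rewrite geq_max sW size_polyN /=.
  apply: leq_trans (size_polyMleq _ _) _.
  move: (size a) (size P) (size Q) sa sPQ sQ => x y n xn yn nk; lia.
rewrite size_mul //; move: (size a) (size b) (size Q) sa => x y n; lia.
Qed.

Lemma ratfun_div {R : realType} (P Q : {poly R}) k m :
  (size P <= k.+1)%N -> (size Q <= m.+1)%N -> Q != 0 ->
  ratfun k m (fun t => P.[t] / Q.[t]).
Proof.
move=> sP sQ Q0; have c0 : lead_coef Q != 0 by rewrite lead_coef_eq0.
exists ((lead_coef Q)^-1 *: P), ((lead_coef Q)^-1 *: Q); split.
- by rewrite size_scale ?invr_eq0.
- by rewrite size_scale ?invr_eq0.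
- by rewrite monicE lead_coefZ mulVf.
apply/funext => t; rewrite !hornerZ invfM invrK mulrACA.
by rewrite mulVf // mul1r.
Qed.

Lemma continuous_itv_bound {R : realType} (f : R -> R) (a b : R) : a <= b ->
  continuous f -> exists2 M, 0 < M & forall t, a <= t <= b -> `|f t| <= M.
Proof.
move=> ab cf; have [|c _ Hc] := @EVT_max R (fun t => `|f t|) a b ab.
  apply: continuous_subspaceT => x.
  by apply: continuous_comp; [exact: cf|exact: norm_continuous].
exists (`|f c| + 1); first by rewrite ltr_wpDl.
by move=> t tab; rewrite ler_wpDr // Hc.
Qed.

Lemma continuous_itv_gt0_bound {R : realType} (f : R -> R) (a b : R) : a <= b ->
  continuous f -> (forall t, a <= t <= b -> 0 < f t) ->
  exists2 m, 0 < m & forall t, a <= t <= b -> m <= f t.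
Proof.
move=> ab cf f0; have [|c cab Hc] := @EVT_min R f a b ab.
  exact: continuous_subspaceT.
by exists (f c); [exact: f0|exact: Hc].
Qed.

(** Here [e] is an error and [x * y] a correction of the same sign. If the correction does not
    overshoot, the error drops by at least [d]; if it does, what remains is at most the correction,
    hence at most E / 2. *)
Lemma ler_norm_descent {R : realFieldType} (e x y E d : R) :
  0 <= e * x -> 0 <= y -> `|e| <= E -> `|x| * y <= E / 2 -> d <= `|x| * y ->
  `|e - x * y| <= Num.max (E - d) (E / 2).
Proof.
move=> ex y0 eE xE dx; rewrite le_max.
have [x0|x0] := leP 0 x.
  move: xE dx; rewrite ger0_norm // => xE dx.
  have xy : 0 <= x * y by rewrite mulr_ge0.
  have e0 : 0 <= e \/ x = 0.
    by case: (ltgtP 0 x) x0 => // [x0 _|<- _]; [left; rewrite pmulr_lge0 in ex|right].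
  case: e0 => [e0|x00].
    move: eE; rewrite ger0_norm // => eE.
    have [h|h] := leP (x * y) e.
      by rewrite ger0_norm ?subr_ge0 //; apply/orP; left; lra.
    by rewrite ltr0_norm ?subr_lt0 //; apply/orP; right; lra.
  by apply/orP; left; move: dx; rewrite x00 !mul0r subr0; lra.
have e0 : e <= 0 by rewrite nmulr_lge0 in ex.
move: xE dx eE; rewrite (ltr0_norm x0) (ler0_norm e0) => xE dx eE.
have xy : x * y <= 0 by rewrite nmulr_rle0.
have [h|h] := leP e (x * y).
  by rewrite ler0_norm ?subr_le0 //; apply/orP; left; lra.
by rewrite gtr0_norm ?subr_gt0 //; apply/orP; right; lra.
Qed.

(* For small positive s the rational function (P - s p) / (Q - s q) moves every
   value of P / Q towards g, by an amount of order s |p Q - q P|. *)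
Lemma ratapprox_improve {R : realType} (g : R -> R) (P Q p q : {poly R}) k (E : R) :
  continuous g -> 0 < E ->
  (size P <= k.+1)%N -> (size Q <= k.+1)%N ->
  (size p <= k.+1)%N -> (size q <= k.+1)%N ->
  (forall t, 0 <= t <= 1 -> 0 < Q.[t]) ->
  (forall t, 0 <= t <= 1 -> `|P.[t] / Q.[t] - g t| <= E) ->
  (forall t, 0 < t < 1 ->
     0 <= (P.[t] / Q.[t] - g t) * (p * Q - q * P).[t]) ->
  (forall t, 0 <= t <= 1 -> (p * Q - q * P).[t] = 0 ->
     `|P.[t] / Q.[t] - g t| < E) ->
  exists (s : R -> R) (E' : R), [/\ ratfun k k s, 0 <= E' < E &
    forall t, 0 < t < 1 -> `|s t - g t| <= E'].
Proof.
move=> cg E0 sP sQ sp sq Qp bE sgn strict; set W := p * Q - q * P in sgn strict.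
have [M1 M10 HM1] := continuous_itv_bound _ _ _ (@ler01 R) (@continuous_horner R Q).
have [M2 M20 HM2] := continuous_itv_bound _ _ _ (@ler01 R) (@continuous_horner R q).
have [M3 M30 HM3] := continuous_itv_bound _ _ _ (@ler01 R) (@continuous_horner R W).
(* [psi] is positive on [0, 1], since the error is below E where W vanishes. By compactness every
   point has either some room below E or |W| bounded away from 0. The factor Q clears the
   denominator and makes [psi] continuous everywhere. *)
pose psi (t : R) := Num.max (E * Q.[t] - `|P.[t] - g t * Q.[t]|) `|W.[t]|.
have cpsi : continuous psi.
  move=> t; have cQ := @continuous_horner R Q t; have cP := @continuous_horner R P t.
  have cW := @continuous_horner R W t.
  have h1 : {for t, continuous (fun u => E * Q.[u] - `|P.[u] - g u * Q.[u]|)}.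
    apply: cvgB; first by apply: cvgM => //; exact: cvg_cst.
    by apply: cvg_norm; apply: cvgB => //; apply: cvgM => //; exact: cg.
  have h2 : {for t, continuous (fun u => `|W.[u]|)} by apply: cvg_norm.
  exact: (@continuous_max R _ _ _ t h1 h2).
have normE t : 0 <= t <= 1 -> `|P.[t] - g t * Q.[t]| = `|P.[t] / Q.[t] - g t| * Q.[t].
  move=> t01; rewrite -{3}(gtr0_norm (Qp t t01)) -normrM mulrBl divfK //.
  by rewrite gt_eqF ?Qp.
have [m1 m10 Hm1] : exists2 m, 0 < m & forall t, 0 <= t <= 1 -> m <= psi t.
  apply: continuous_itv_gt0_bound => // t t01; rewrite lt_max normr_gt0.
  have [W0|_] := eqVneq W.[t] 0; rewrite /= ?orbT // orbF subr_gt0 normE //.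
  by rewrite ltr_pM2r ?Qp // strict.
have [m2 m20 Hm2] := continuous_itv_gt0_bound _ _ _ (@ler01 R) (@continuous_horner R Q) Qp.
pose M := M1 + M2 + M3; pose c := Num.min m1 m2.
have c0 : 0 < c by rewrite lt_min m10.
have M0 : 0 < M by rewrite /M; lra.
have HQ t : 0 <= t <= 1 -> c <= Q.[t] <= M.
  move=> t01; have := HM1 _ t01; rewrite (gtr0_norm (Qp t t01)).
  by rewrite ge_min Hm2 // orbT /= /M; lra.
have Hq t : 0 <= t <= 1 -> `|q.[t]| <= M by move=> /HM2; rewrite /M; lra.
have HW t : 0 <= t <= 1 -> `|W.[t]| <= M by move=> /HM3; rewrite /M; lra.
have Hpsi t : 0 <= t <= 1 -> c <= psi t by move=> /Hm1; rewrite ge_min => ->.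
have cM : c <= M by have := HQ 0; rewrite lexx ler01 => /(_ isT) /andP[]; exact: le_trans.
(* The three bounds keep Q - s q above c / 2, the correction below E / 2, and the correction below c
   / (2 M), half of the room c / M used in the first case at the end. *)
pose s := Num.min (c / (2 * M)) (Num.min (E * c ^+ 2 / (4 * M)) (c ^+ 3 / (4 * M ^+ 2))).
have s0 : 0 < s by rewrite !lt_min !divr_gt0 ?mulr_gt0 ?exprn_gt0.
have s1 : s * M <= c / 2.
  apply: (@le_trans _ _ (c / (2 * M) * M)); first by rewrite ler_pM2r // ge_min lexx.
  by rewrite le_eqVlt; apply/orP; left; apply/eqP; field; rewrite gt_eqF.
have s2 : s * M * (2 / c ^+ 2) <= E / 2.
  apply: (@le_trans _ _ (E * c ^+ 2 / (4 * M) * M * (2 / c ^+ 2))).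
    rewrite ler_pM2r ?divr_gt0 ?exprn_gt0 // ler_pM2r // !ge_min lexx orbT //.
  by rewrite le_eqVlt; apply/orP; left; apply/eqP; field; rewrite !gt_eqF.
have s3 : s * M * (2 / c ^+ 2) <= c / (2 * M).
  apply: (@le_trans _ _ (c ^+ 3 / (4 * M ^+ 2) * M * (2 / c ^+ 2))).
    rewrite ler_pM2r ?divr_gt0 ?exprn_gt0 // ler_pM2r // !ge_min lexx !orbT //.
  by rewrite le_eqVlt; apply/orP; left; apply/eqP; field; rewrite !gt_eqF.
have HD t : 0 <= t <= 1 -> c / 2 <= (Q - s *: q).[t] <= 2 * M.
  move=> t01; rewrite hornerD hornerN hornerZ.
  have : `|s * q.[t]| <= c / 2.
    by rewrite normrM gtr0_norm // (le_trans _ s1) // ler_pM2l // Hq.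
  by rewrite ler_norml; have := HQ _ t01; lra.
have HB t : 0 <= t <= 1 -> 1 / (2 * M ^+ 2) <= (Q.[t] * (Q - s *: q).[t])^-1 <= 2 / c ^+ 2.
  move=> t01; have /andP[Q1 Q2] := HQ _ t01; have /andP[D1 D2] := HD _ t01.
  have D0 : 0 < (Q - s *: q).[t] by apply: lt_le_trans D1; rewrite divr_gt0.
  have -> : 1 / (2 * M ^+ 2) = (M * (2 * M))^-1 by field; rewrite gt_eqF.
  have -> : 2 / c ^+ 2 = (c * (c / 2))^-1 by field; rewrite gt_eqF.
  rewrite !lef_pV2 ?posrE ?mulr_gt0 ?divr_gt0 ?Qp //.
  by rewrite !ler_pM // ltW // ?divr_gt0 // Qp.
exists (fun t => (P - s *: p).[t] / (Q - s *: q).[t]).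
exists (Num.max (E - Num.min (c / (2 * M)) (s * c / (2 * M ^+ 2))) (E / 2)); split.
- apply: ratfun_div.
  + by rewrite (leq_trans (size_polyD _ _)) // geq_max sP size_polyN (leq_trans (size_scale_leq _ _)).
  + by rewrite (leq_trans (size_polyD _ _)) // geq_max sQ size_polyN (leq_trans (size_scale_leq _ _)).
  + apply/eqP => D0; have := HD 0; rewrite lexx ler01 D0 horner0 => /(_ isT)/andP[].
    by rewrite leNgt divr_gt0.
- rewrite le_max gt_max; apply/andP; split; first by rewrite orbC divr_ge0 // ltW.
  rewrite ltrBlDr ltrDl lt_min !divr_gt0 ?mulr_gt0 ?exprn_gt0 //=; lra.
move=> t t01; have t01' : 0 <= t <= 1 by move: t01 => /andP[? ?]; rewrite !ltW.
have /andP[Q1 Q2] := HQ _ t01'; have /andP[D1 D2] := HD _ t01'.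
have /andP[B1 B2] := HB _ t01'.
have D0 : 0 < (Q - s *: q).[t] by apply: lt_le_trans D1; rewrite divr_gt0.
have Q0 := Qp _ t01'.
set y := s * (Q.[t] * (Q - s *: q).[t])^-1.
have y0 : 0 <= y by rewrite mulr_ge0 ?invr_ge0 ?mulr_ge0 // ltW.
have -> : (P - s *: p).[t] / (Q - s *: q).[t] - g t =
    (P.[t] / Q.[t] - g t) - W.[t] * y.
  rewrite /y /W; move: D0; rewrite !(hornerD, hornerN, hornerZ, hornerM) => D0.
  by field; rewrite !gt_eqF.
have Wy : `|W.[t]| * y <= s * M * (2 / c ^+ 2).
  rewrite /y mulrCA mulrA ler_pM ?mulr_ge0 ?invr_ge0 ?mulr_ge0 ?(ltW s0) ?(ltW Q0) ?(ltW D0) //.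
  by rewrite ler_pM2l // HW.
(* Either the old error leaves room c / M and the correction uses at most half of it, or |W| >= c
   and the correction is a descent of controlled size. *)
have := Hpsi _ t01'; rewrite le_max normE // => /orP[h|h].
  have e1 : `|P.[t] / Q.[t] - g t| <= E - c / M.
    have : c / M <= E - `|P.[t] / Q.[t] - g t|; last lra.
    rewrite ler_pdivrMr //; apply: le_trans h _.
    by rewrite -mulrBl ler_wpM2l // subr_ge0 bE.
  rewrite le_max; apply/orP; left.
  apply: le_trans (ler_normB _ _) _; rewrite normrM (ger0_norm y0).
  have : Num.min (c / (2 * M)) (s * c / (2 * M ^+ 2)) <= c / (2 * M) by rewrite ge_min lexx.
  have : c / M = c / (2 * M) + c / (2 * M) by field; rewrite gt_eqF.
  lra.
apply: le_trans (ler_norm_descent _ _ _ _ (s * c / (2 * M ^+ 2)) (sgn _ t01) y0 (bE _ t01') _ _) _.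
- exact: le_trans Wy s2.
- have -> : s * c / (2 * M ^+ 2) = s * (c * (1 / (2 * M ^+ 2))) by rewrite mul1r mulrA.
  rewrite /y (mulrCA `|_|) ler_pM2l // ler_pM ?(ltW c0) //.
  by rewrite divr_ge0 // mulr_ge0 // exprn_ge0 // ltW.
by rewrite ge_max !le_max lexx orbT andbT lerD2l lerN2 ge_min lexx orbT.
Qed.

Lemma uniform_error_le {R : realType} (alpha : R) (s : R -> R) (e : R) :
  0 <= e -> (forall t, 0 < t < 1 -> `|s t - t `^ alpha| <= e) ->
  (uniform_error alpha s <= e%:E)%E.
Proof.
move=> e0 H; apply/uniform_error_leP => //.
apply: (@negligibleS _ _ _ _ set0); last exact: negligible_set0.
by move=> t [t01]; rewrite distrC ltNge H.
Qed.

Lemma negligible_finite {R : realType} (s : seq R) :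
  (@lebesgue_measure R).-negligible [set` s].
Proof.
have cs : countable [set` s] by apply: finite_set_countable; exact: finite_seq.
exists [set` s]; split=> //.
  exact: countable_measurable.
exact: countable_lebesgue_measure0.
Qed.

Lemma best_ratapprox_fin {R : realType} (k : nat) (alpha : R) (r : R -> R) :
  0 < alpha -> best_ratapprox k alpha r ->
  exists2 e, 0 <= e & uniform_error alpha r = e%:E.
Proof.
move=> a0 [_ best].
have le1 : (uniform_error alpha r <= 1%:E)%E.
  apply: le_trans (best _ (ratfun_div 0 1 k k _ _ _)) _.
  - by rewrite size_poly0.
  - by rewrite size_poly1.
  - exact: oner_neq0.
  apply: uniform_error_le => // t /andP[t0 t1].
  rewrite horner0 mul0r sub0r normrN ger0_norm ?powR_ge0 //.
  have <- : (1 : R) `^ alpha = 1 by rewrite powR1.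
  by rewrite ge0_ler_powR ?nnegrE ?ltW.
have ge0 : (0 <= uniform_error alpha r)%E by exact: Lnorm_ge0.
exists (fine (uniform_error alpha r)); first exact: fine_ge0.
by rewrite fineK // ge0_fin_numE // (le_lt_trans le1) // ltry.
Qed.

(** Clearing denominators and cancelling G turn the almost everywhere bound into an inequality
    between continuous functions, which holds at every point, zeros of Q included. *)
Lemma ratfun_error_bound {R : realType} (alpha : R) (P Q P0 Q0 G : {poly R}) (e : R) :
  0 < alpha < 1 -> 0 <= e -> Q != 0 -> P = P0 * G -> Q = Q0 * G ->
  (uniform_error alpha (fun t => P.[t] / Q.[t])%R <= e%:E)%E ->
  forall t, 0 <= t <= 1 -> `|P0.[t] - `|t| `^ alpha * Q0.[t]| <= e * `|Q0.[t]|.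
Proof.
move=> a01 e0 Qn0 PE QE /(uniform_error_leP _ _ _ e0) Hneg.
have /andP[a0 _] := a01.
(* With 0 as second polynomial this lists the zeros of Q in ]0, 1[, a negligible set. *)
have [|z _ zE] := poly_powR_zeros Q 0 alpha a01; first by rewrite Qn0.
apply: ae_le_continuous.
- move=> t; apply: cvg_norm; apply: cvgB; first exact: continuous_horner.
  by apply: cvgM; [exact: continuous_normr_powR|exact: continuous_horner].
- move=> t; apply: cvgM; first exact: cvg_cst.
  by apply: cvg_norm; exact: continuous_horner.
have := negligibleU Hneg (negligible_finite z); apply: negligibleS.
move=> t [t01 bad]; have t0 : 0 < t by case/andP: t01.
have [tz|tz] := boolP (t \in z); first by right.
left.
have Qt : Q.[t] != 0.
  by apply: contraNneq tz => Qt; apply/zE; split=> //; rewrite Qt horner0 mulr0.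
split=> //; rewrite -(ltr_pM2r (x := `|Q.[t]|)) ?normr_gt0 // -normrM mulrBl divfK //.
have Gt : G.[t] != 0 by move: Qt; rewrite QE hornerM mulf_eq0 negb_or => /andP[].
rewrite PE QE !hornerM mulrA -mulrBl !normrM mulrA ltr_pM2r ?normr_gt0 //.
by move: bad; rewrite (gtr0_norm t0) distrC.
Qed.

Lemma poly_powR_neq {R : realType} (P Q : {poly R}) (alpha : R) :
  0 < alpha < 1 -> (P != 0) || (Q != 0) ->
  exists2 t, 0 < t < 1 & P.[t] != t `^ alpha * Q.[t].
Proof.
move=> a01 PQ; have [z uz zE] := poly_powR_zeros P Q alpha a01 PQ.
apply: contrapT => /forall2NP H.
pose s : seq R := [seq (i.+2%:R)^-1 | i <- iota 0 (size z).+1].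
have us : uniq s.
  rewrite map_inj_uniq ?iota_uniq // => i j /invr_inj/eqP.
  by rewrite eqr_nat => /eqP[].
have : (size s <= size z)%N.
  apply: uniq_leq_size us _ => t /mapP[i _ ->]; apply/zE.
  have h1 : 0 < (i.+2%:R : R)^-1 by rewrite invr_gt0 ltr0n.
  have h2 : (i.+2%:R : R)^-1 < 1 by rewrite invf_lt1 ?ltr0n // ltr1n.
  have h : 0 < (i.+2%:R : R)^-1 < 1 by rewrite h1.
  by split=> //; have [/(_ h)|/negP] := H (i.+2%:R)^-1; last by rewrite negbK => /eqP.
by rewrite size_map size_iota ltnn.
Qed.

Lemma best_ratapprox_zeros {R : realType} (k : nat) (alpha : R) (r : R -> R) :
  0 < alpha < 1 -> best_ratapprox k alpha r ->
  exists (P Q : {poly R}) (z : seq R),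
    [/\ (size P <= k.+1)%N, (size Q <= k.+1)%N, Q \is monic &
        r = (fun t => P.[t] / Q.[t])] /\
    [/\ uniq z, size z = k.*2.+1 &
        {in z, forall t, 0 < t < 1 /\ P.[t] = t `^ alpha * Q.[t]}].
Proof.
move=> a01 bestr; have /andP[a0 _] := a01.
have [e e0 errE] := best_ratapprox_fin k alpha r a0 bestr.
have [[P [Q [sP sQ mQ rE]]] best] := bestr.
have Qn0 : Q != 0 by rewrite monic_neq0.
pose G := gcdp P Q; pose P0 := P %/ G; pose Q0 := Q %/ G.
have PE : P = P0 * G by rewrite divpK ?dvdp_gcdl.
have QE : Q = Q0 * G by rewrite divpK ?dvdp_gcdr.
have cop0 : coprimep P0 Q0 by rewrite coprimep_div_gcd ?Qn0 ?orbT.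
have bd0 : forall t, 0 <= t <= 1 -> `|P0.[t] - `|t| `^ alpha * Q0.[t]| <= e * `|Q0.[t]|.
  by apply: (ratfun_error_bound alpha P Q P0 Q0 G); rewrite -?rE ?errE.
(* At a zero of Q0 the bound would force P0 to vanish as well, against coprimality. *)
have Q0n0 t : 0 <= t <= 1 -> Q0.[t] != 0.
  move=> /bd0 + ; apply: contraTneq => Qt; rewrite Qt mulr0 normr0 mulr0 subr0 -ltNge.
  rewrite normr_gt0; apply/eqP => Pt.
  by have /coprimep_root := cop0 => /(_ t); rewrite /root Pt Qt !eqxx => /(_ isT).
have c0 : Q0.[0] != 0 by apply: Q0n0; rewrite lexx ler01.
(* Q0 keeps its sign on [0, 1]; the factor Q0(0) makes it positive there. *)
pose P1 := Q0.[0] *: P0; pose Q1 := Q0.[0] *: Q0.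
have Q1p t : 0 <= t <= 1 -> 0 < Q1.[t].
  move=> t01; have h : Q1.[t] = Q0.[0] * Q0.[t] by rewrite hornerZ.
  rewrite h lt_neqAle eq_sym mulf_neq0 ?(Q0n0 _ t01) //= leNgt; apply/negP => lt0.
  have [c + /eqP] := ltr_sign_change_zero _ _ _ (@continuous_horner R Q0) lt0.
  have /andP[t0 t1] := t01; rewrite min_l // max_r // => /andP[/ltW cc0 /ltW ct].
  by apply/negP/Q0n0; rewrite cc0 (le_trans ct).
have cop1 : coprimep P1 Q1 by rewrite coprimepZl // coprimepZr.
have sP1 : (size P1 <= k.+1)%N by rewrite size_scale // (leq_trans (leq_divp _ _)).
have sQ1 : (size Q1 <= k.+1)%N by rewrite size_scale // (leq_trans (leq_divp _ _)).
have Q1n0 : Q1 != 0.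
  have : 0 < Q1.[0] by apply: Q1p; rewrite lexx ler01.
  by apply: contraTneq => ->; rewrite horner0 ltxx.
pose f t := P1.[t] - `|t| `^ alpha * Q1.[t].
have fE t : 0 <= t <= 1 -> P1.[t] / Q1.[t] - `|t| `^ alpha = f t / Q1.[t].
  by move=> /Q1p h; rewrite /f mulrBl mulfK // gt_eqF.
have bd1 t : 0 <= t <= 1 -> `|P1.[t] / Q1.[t] - `|t| `^ alpha| <= e.
  move=> t01; rewrite fE // normrM normfV ler_pdivrMr ?normr_gt0 ?gt_eqF ?Q1p //.
  rewrite /f !hornerZ mulrCA -mulrBr !normrM mulrCA ler_wpM2l //; exact: bd0.
have PQ1 : (P1 != 0) || (Q1 != 0) by rewrite Q1n0 orbT.
have ep : 0 < e.
  rewrite lt_neqAle e0 andbT eq_sym; apply/eqP => e00.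
  have [t t01 /eqP] := poly_powR_neq P1 Q1 alpha a01 PQ1; apply.
  have /andP[t0 t1] := t01; have t01' : 0 <= t <= 1 by rewrite !ltW.
  have := bd1 _ t01'; rewrite e00 normr_le0 fE // mulf_eq0 invr_eq0 (gt_eqF (Q1p _ t01')) orbF.
  by rewrite /f gtr0_norm // subr_eq0 => /eqP.
have [z uz zE] := poly_powR_zeros P1 Q1 alpha a01 PQ1.
have cf : continuous f.
  move=> t; apply: cvgB; first exact: continuous_horner.
  by apply: cvgM; [exact: continuous_normr_powR|exact: continuous_horner].
have [||s [d [us sz Hs]]] := sign_change_polynomial f 0 1 (sort <=%R z) cf _ (@ltr01 R).
- rewrite lt_path_sortedE lt_sorted_uniq_le sort_uniq uz sort_le_sorted !andbT.
  by apply/allP => t; rewrite mem_sort => /zE[/andP[]].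
- move=> t; rewrite mem_sort zE /f; split=> -[t01 E]; split=> //; have /andP[t0 _] := t01.
    by rewrite gtr0_norm // E subrr.
  by move/eqP: E; rewrite gtr0_norm // subr_eq0 => /eqP.
have s0 : {in s, forall t, 0 < t < 1 /\ P1.[t] = t `^ alpha * Q1.[t]}.
  by move=> t /sz; rewrite mem_sort => /zE.
set n := maxn (size P1) (size Q1).
have nk : (n <= k.+1)%N by rewrite geq_max sP1.
have n0 : (0 < n)%N by rewrite leq_max !size_poly_gt0 Q1n0 orbT.
have ns : (k + n <= size s)%N.
  rewrite leqNgt; apply/negP => sn.
  (* W f >= 0 on ]0, 1[, and W has few enough roots to be a combination of P1 and Q1;
     [ratapprox_improve] then contradicts optimality. *)
  pose W := (-1) ^+ d *: \prod_(x <- s) ('X - x%:P).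
  have WE t : W.[t] = (-1) ^+ d * \prod_(x <- s) (t - x).
    by rewrite hornerZ horner_prod; under eq_bigr do rewrite hornerXsubC.
  have sW : (size W <= k + n)%N.
    by rewrite (leq_trans (size_scale_leq _ _)) // size_prod_XsubC.
  have [a [b [sa sb Wab]]] : exists a b : {poly R},
      [/\ (size a <= k.+1)%N, (size b <= k.+1)%N & W = a * P1 + b * Q1].
    have [le|/ltnW le] := leqP (size P1) (size Q1).
      by apply: coprimep_combination => //; rewrite -(maxn_idPr le).
    have [||b [a [sb sa ->]]] := coprimep_combination Q1 P1 W k _ le sP1.
    - by rewrite coprimep_sym.
    - by rewrite -(maxn_idPl le).
    by exists a, b; rewrite addrC.
  have WE' : b * Q1 - (- a) * P1 = W by rewrite Wab mulNr opprK addrC.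
  have [|||s' [E' [rs' /andP[E'0 E'e] Hs']]] := ratapprox_improve (fun t => `|t| `^ alpha) P1 Q1 b (- a) k e
    (continuous_normr_powR _ a0) ep sP1 sQ1 sb _ Q1p bd1.
  - by rewrite size_polyN.
  - move=> t t01; have t01' : 0 <= t <= 1 by move: t01 => /andP[? ?]; rewrite !ltW.
    rewrite fE // WE' WE mulrAC mulr_ge0 ?invr_ge0 ?(ltW (Q1p _ _)) //.
    by rewrite mulrCA Hs.
  - move=> t t01; rewrite WE' WE => /eqP; rewrite mulf_eq0 signr_eq0 /= => /eqP/eqP.
    rewrite prodf_seq_eq0 => /hasP[x /s0[/andP[x0 _] Px]]; rewrite subr_eq0 => /eqP tx.
    move: t01; rewrite tx => /Q1p Qx.
    by rewrite (gtr0_norm x0) Px mulfK ?(gt_eqF Qx) // subrr normr0.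
  have : (uniform_error alpha s' <= E'%:E)%E.
    apply: uniform_error_le => // t t01; have := Hs' _ t01.
    by case/andP: t01 => t0 _; rewrite (gtr0_norm t0).
  move/(le_trans (best _ rs')); rewrite errE lee_fin leNgt E'e //.
exists P, Q, s; split; first by [].
(* Descartes' rule gives exactly 2 n - 1 zeros. As there are at least k + n of them, n >= k + 1;
   together with n <= k + 1 the count is 2 k + 1. *)
have [||||szE _ _] := poly_powR_alternate P1 Q1 alpha n.-1 s a01 _ _ PQ1 us.
- by rewrite prednK // leq_maxl.
- by rewrite prednK // leq_maxr.
- by move=> t /s0[/andP[]].
- by clear -ns nk n0; clearbody n; move: (size s) ns => x; lia.
split=> //; first by clear -szE ns nk n0; clearbody n; move: (size s) szE ns => x; lia.
move=> t /s0[t01 /eqP]; rewrite !hornerZ mulrCA (inj_eq (mulfI c0)) => /eqP Pt.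
by split=> //; rewrite PE QE !hornerM Pt mulrA.
Qed.

(** * Divided differences of powers *)

Lemma continuous_antiderivative {R : realType} (f : R -> R) (U : R) : continuous f ->
  exists K : R -> R, forall t, - U < t < U -> is_derive t (1 : R) K (f t).
Proof.
move=> cf; exists (fun t => \int[lebesgue_measure]_(u in `[- U, t]) f u)%R.
move=> t /andP[t1 t2].
have [|||dK1 dK2] := @continuous_FTC1 R f (BLeft (- U)) t U t2.
- apply: continuous_compact_integrable; first exact: segment_compact.
  exact: continuous_subspaceT.
- by rewrite /= lte_fin.
- exact: cf.
by apply: DeriveDef; [exact: dK1|rewrite -derive1E; exact: dK2].
Qed.

Lemma MVT_itvoo {R : realType} (K f : R -> R) (a b u v : R) :
  (forall t, a < t < b -> is_derive t (1 : R) K (f t)) ->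
  a < u -> u <= v -> v < b ->
  exists2 w, u <= w <= v & K v - K u = f w * (v - u).
Proof.
move=> dK au uv vb; have dK' t : u <= t -> t <= v -> is_derive t (1 : R) K (f t).
  by move=> ut tv; apply: dK; rewrite (lt_le_trans au) ?(le_lt_trans _ vb).
have [t||w] := @MVT_segment R K f u v uv.
- by move=> /itvP uvt; apply: dK'; rewrite uvt.
- apply: derivable_within_continuous => t /itvP uvt.
  by have [] := dK' t; rewrite ?uvt.
- by rewrite in_itv /=; exists w.
Qed.

(** This bounds a boundary term: [c] is an end T or - T of the integration range, and the segment
    between c - l and c stays where |t| >= S, so that [f] is at most [eta] on it. *)
Lemma antiderivative_shift_le {R : realType} (K f : R -> R) (U S L T eta c l : R) :
  (forall t, - U < t < U -> is_derive t (1 : R) K (f t)) ->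
  (forall t, 0 <= f t) -> (forall t, S <= `|t| -> f t <= eta) ->
  S + L <= T -> T + L < U -> `|c| = T -> `|l| <= L ->
  `|K (c - l) - K c| <= eta * L.
Proof.
move=> dK f0 fS SLT TLU cT lL.
have far u v : - U < u -> u <= v -> v < U -> v - u <= L ->
    (forall w, u <= w <= v -> S <= `|w|) -> `|K v - K u| <= eta * L.
  move=> Uu uv vU uvL far; have [w uwv ->] := MVT_itvoo _ _ _ _ _ _ dK Uu uv vU.
  rewrite ger0_norm ?mulr_ge0 ?subr_ge0 //.
  by apply: ler_pM; rewrite ?subr_ge0 // fS // far.
have cc : c = T \/ c = - T.
  by move/eqP: cT; rewrite eqr_norml => /andP[/orP[/eqP|/eqP] -> _]; [left|right].
have T0 : 0 <= T by rewrite -cT.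
move: lL; rewrite ler_norml => /andP[l1 l2].
have [[c1 c2] [c3 c4]] : (- U < c /\ c < U) /\ (- U < c - l /\ c - l < U).
  by clear -cc l1 l2 TLU T0; case: cc => ->; (split; split); lra.
have S_le w : Num.min c (c - l) <= w <= Num.max c (c - l) -> S <= `|w|.
  rewrite ge_min le_max ler_normr => /andP[w1 w2]; apply/orP.
  clear -cc w1 w2 l1 l2 SLT; case: cc => cE; rewrite cE in w1 w2; [left|right].
    by case/orP: w1 => ?; lra.
  by case/orP: w2 => ?; lra.
have [l0|l0] := leP 0 l.
  have cl : c - l <= c by rewrite gerBl.
  rewrite distrC; apply: far => // [|w h]; first by rewrite subKr.
  by apply: S_le; rewrite min_r ?max_l.
have cl : c <= c - l by rewrite lerDl oppr_ge0 ltW.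
apply: far => // [|w h]; first by rewrite addrC addKr; clear -l1; lra.
by apply: S_le; rewrite min_l ?max_r.
Qed.

Lemma is_derive_sum_shift {R : realType} (K f : R -> R) (s : seq R) (b l : R -> R) (t : R) :
  {in s, forall y, is_derive (t - l y) (1 : R) K (f (t - l y))} ->
  is_derive t (1 : R) (fun t => \sum_(y <- s) b y * K (t - l y))
    (\sum_(y <- s) b y * f (t - l y)).
Proof.
move=> dK.
have -> : (fun t => \sum_(y <- s) b y * K (t - l y)) =
    \sum_(i < size s) (fun t => b s`_i * K (t - l s`_i)).
  by apply/funext => u; rewrite fct_sumE (big_nth 0) big_mkord.
rewrite (big_nth 0) big_mkord; apply: is_derive_sum => i.
have d1 : is_derive t (1 : R) (fun u : R => u - l s`_i) 1.
  have := @is_deriveB _ _ _ (@id R) (cst (l s`_i)) t 1 1 0 (is_derive_id _ _) (is_derive_cst _ _ _).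
  by rewrite subr0.
have d2 := dK _ (mem_nth 0 (ltn_ord i)).
have := @is_deriveZ _ _ _ _ (b s`_i) t 1 _ (@is_derive1_comp _ K _ t _ _ d2 d1).
by rewrite mulr1.
Qed.

(* Integrating the hypothesis over [-T, T] compares sum b with the integral of
   kappa, up to boundary terms, which are small when T is large. *)
Lemma kernel_sum_ge0 {R : realType} (kappa : R -> R) (s : seq R) (b l : R -> R) :
  continuous kappa -> (forall t, 0 < kappa t) ->
  (forall e, 0 < e -> exists S : R, forall t, S <= `|t| -> kappa t <= e) ->
  (forall t, 0 <= \sum_(y <- s) b y * kappa (t - l y)) ->
  0 <= \sum_(y <- s) b y.
Proof.
move=> ck k0 kdecay sum0; rewrite leNgt; apply/negP => sneg.
pose B := \sum_(y <- s) `|b y|; pose L := 1 + \sum_(y <- s) `|l y|.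
have B0 : 0 <= B by apply: sumr_ge0.
have L0 : 0 < L by rewrite ltr_pwDl // sumr_ge0.
have lL y : y \in s -> `|l y| <= L.
  move=> ys; rewrite /L (big_rem y ys) /= addrCA lerDl addr_ge0 //.
  by apply: sumr_ge0.
have [|m m0 Hm] := @continuous_itv_gt0_bound R kappa (-1) 1 _ ck (fun t _ => k0 t).
  by rewrite (le_trans (lerN10 R)).
pose d := - \sum_(y <- s) b y; have d0 : 0 < d by rewrite oppr_gt0.
(* With this [eta] the boundary terms add up to at most 2 B eta L < d m, while the main term is at
   most - 2 d m because T >= 1 and kappa >= m on [-1, 1]. *)
pose eta := d * m / (2 * (B + 1) * L).
have B1 : 0 < B + 1 by rewrite ltr_wpDl.
have eta0 : 0 < eta by rewrite divr_gt0 // !mulr_gt0.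
have [S HS] := kdecay _ eta0.
have [T T1 SLT] : exists2 T, 1 <= T & S + L <= T.
  by exists (Num.max 1 (S + L)); rewrite le_max lexx ?orbT.
pose U := T + L + 1.
have TLU : T + L < U by rewrite ltrDl.
have TU : T < U by rewrite (lt_trans _ TLU) // ltrDl.
have T0 : 0 <= T by rewrite (le_trans _ T1).
have NTU : - U < - T by rewrite ltrN2.
have [K dK] := continuous_antiderivative kappa U ck.
have Kmono u v : - U < u -> u <= v -> v < U -> K u <= K v.
  move=> Uu uv vU; have [w _ E] := MVT_itvoo _ _ _ _ _ _ dK Uu uv vU.
  by rewrite -subr_ge0 E mulr_ge0 ?subr_ge0 // ltW.
have Kshift c y : `|c| = T -> y \in s -> `|K (c - l y) - K c| <= eta * L.
  move=> cT /lL; apply: (antiderivative_shift_le _ _ _ _ _ _ _ _ _ dK _ HS SLT TLU cT).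
  by move=> t; exact: ltW.
pose G (t : R) := \sum_(y <- s) b y * K (t - l y).
have dG t : - T <= t <= T ->
    is_derive t (1 : R) G (\sum_(y <- s) b y * kappa (t - l y)).
  move=> /andP[t1 t2]; apply: is_derive_sum_shift => y /lL.
  rewrite ler_norml => /andP[l1 l2]; apply: dK.
  by clear -t1 t2 l1 l2 TLU; apply/andP; split; lra.
have GT : G (- T) <= G T.
  have [|t|| w _ E] := @MVT_segment R G (fun t => \sum_(y <- s) b y * kappa (t - l y)) (- T) T.
  - by rewrite (le_trans _ T0) // oppr_le0.
  - by move=> /itvP tT; apply: dG; rewrite !tT.
  - apply: derivable_within_continuous => t /itvP tT.
    by have [] := dG t; rewrite // !tT.
  - by rewrite -subr_ge0 E mulr_ge0 // opprK addr_ge0.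
have step : \sum_(y <- s) b y * (K (T - l y) - K (- T - l y)) <=
    \sum_(y <- s) (b y * (K T - K (- T)) + `|b y| * (2 * (eta * L))).
  rewrite big_seq [leRHS]big_seq; apply: ler_sum => y ys.
  have h1 : `|K (T - l y) - K T| <= eta * L by apply: Kshift; rewrite ?ger0_norm.
  have h2 : `|K (- T - l y) - K (- T)| <= eta * L.
    by apply: Kshift; rewrite ?normrN ?ger0_norm.
  rewrite -lerBlDl -mulrBr.
  apply: le_trans (ler_norm _) _; rewrite normrM ler_wpM2l //.
  have -> : K (T - l y) - K (- T - l y) - (K T - K (- T)) =
     (K (T - l y) - K T) - (K (- T - l y) - K (- T)) by clear; ring.
  by rewrite (le_trans (ler_normB _ _)) // mulr_natl mulr2n lerD.
have : 0 <= \sum_(y <- s) b y * (K (T - l y) - K (- T - l y)).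
  by under eq_bigr do rewrite mulrBr; rewrite sumrB subr_ge0.
move/le_trans/(_ step); rewrite big_split /= -!mulr_suml -/B.
have KK : 2 * m <= K T - K (- T).
  have U1 : 1 < U by rewrite (le_lt_trans T1).
  have U2 : - U < -1 by rewrite ltrN2.
  have [w w11 E] := MVT_itvoo _ _ _ _ _ _ dK U2 (le_trans (lerN10 R) ler01) U1.
  have N11 : (-1 : R) < 1 by rewrite (lt_trans (ltrN10 R)).
  have h1 : K 1 <= K T by apply: Kmono => //; exact: lt_trans U2 N11.
  have h2 : K (- T) <= K (- 1) by apply: Kmono; rewrite ?lerN2 //; exact: lt_trans N11 U1.
  have := Hm _ w11; clear -h1 h2 E; move: E; lra.
have -> : \sum_(y <- s) b y = - d by rewrite opprK.
have etaE : eta * (2 * (B + 1) * L) = d * m by rewrite /eta divfK // gt_eqF // !mulr_gt0.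
have : 0 < eta * L by rewrite mulr_gt0.
have : 0 < d * m by rewrite mulr_gt0.
clear -d0 KK etaE B0; clearbody d eta B L.
nra.
Qed.

(** The kernel is at most exp(alpha t) for negative t and exp((alpha - 1) t) for positive t; [c] is
    the slower of the two rates. *)
Lemma kernel_decay {R : realType} (alpha : R) : 0 < alpha < 1 ->
  forall e, 0 < e -> exists S : R, forall t, S <= `|t| ->
    expR (alpha * t) / (1 + expR t) <= e.
Proof.
move=> /andP[a0 a1] e e0; pose c := Num.min alpha (1 - alpha).
have c0 : 0 < c by rewrite lt_min a0 subr_gt0.
exists (`|ln e| / c) => t; rewrite ler_pdivrMr // => ht.
have le_e (u : R) : `|ln e| <= - u -> expR u <= e.
  move=> h; rewrite -[leRHS](lnK (x := e)) ?posrE // ler_expR -lerN2.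
  by rewrite (le_trans (ler_norm _)) // normrN.
have ca : c <= alpha by rewrite ge_min lexx.
have ca1 : c <= 1 - alpha by rewrite ge_min lexx orbT.
rewrite ler_pdivrMr ?addr_gt0 ?expR_gt0 //.
have [t0|t0] := leP 0 t.
- rewrite (ger0_norm t0) in ht.
  have -> : expR (alpha * t) = expR ((alpha - 1) * t) * expR t by rewrite -expRD; congr expR; ring.
  apply: ler_pM; rewrite ?expR_ge0 //; last by rewrite lerDr.
  by apply: le_e; rewrite (le_trans ht) // -mulNr opprB mulrC ler_wpM2r.
- rewrite (ltr0_norm t0) in ht.
  rewrite -[leLHS]mulr1; apply: ler_pM; rewrite ?expR_ge0 ?ler01 //; last by rewrite lerDl expR_ge0.
  by apply: le_e; rewrite (le_trans ht) // -mulrN mulrC ler_wpM2r // oppr_ge0 ltW.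
Qed.

(** The Lagrange form of the divided difference, meaningful for distinct nodes. *)
Definition divdiff {R : fieldType} (s : seq R) (phi : R -> R) : R :=
  \sum_(y <- s) phi y / \prod_(z <- s | z != y) (y - z).

(** The divided difference is the coefficient of degree [size s] - 1 in the Lagrange interpolant,
    which is p itself. *)
Lemma divdiff_poly {R : fieldType} (s : seq R) (p : {poly R}) :
  uniq s -> (size p < size s)%N -> divdiff s (horner p) = 0.
Proof.
move=> us sp.
pose ell (y : R) : {poly R} := \prod_(z <- s | z != y) ('X - z%:P).
have ellE y x : (ell y).[x] = \prod_(z <- s | z != y) (x - z).
  by rewrite horner_prod; under eq_bigr do rewrite hornerXsubC.
have sell y : y \in s -> size (ell y) = size s.
  move=> ys; rewrite /ell -big_filter size_prod_XsubC size_filter.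
  by rewrite -(count_predC (pred1 y) s) (count_uniq_mem _ us) ys.
have mell y : ell y \is monic by rewrite /ell -big_filter monic_prod_XsubC.
have ell0 y x : x \in s -> x != y -> (ell y).[x] = 0.
  by move=> xs xy; rewrite ellE (big_rem x xs) /= xy subrr mul0r.
have ell_neq0 y : (ell y).[y] != 0.
  rewrite ellE prodf_seq_neq0; apply/allP => z _; apply/implyP => zy.
  by rewrite subr_eq0 eq_sym.
pose q : {poly R} := \sum_(y <- s) (p.[y] / (ell y).[y]) *: ell y.
have qE x : q.[x] = \sum_(y <- s) p.[y] / (ell y).[y] * (ell y).[x].
  by rewrite horner_sum; apply: eq_bigr => y _; exact: hornerZ.
have pq : p = q.
  apply/eqP; rewrite -subr_eq0; apply/negPn/negP => pq0.
  have : (size s < size (p - q)%R)%N.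
    apply: (max_poly_roots pq0 _ us); apply/allP => x xs.
    suff qx : q.[x] = p.[x] by rewrite rootE hornerD hornerN qx subrr.
    rewrite qE (bigD1_seq x xs us) big1 => [|y yx]; last first.
      by rewrite (ell0 y x xs) ?mulr0 1?eq_sym.
    by rewrite /= addr0; exact: (divfK (ell_neq0 x)).
  rewrite ltnNge; apply/negP; rewrite negbK.
  apply: leq_trans (size_polyD _ _) _; rewrite geq_max (ltnW sp) size_polyN /=.
  rewrite /q big_seq; apply: (big_ind (fun u : {poly R} => (size u <= size s)%N)).
  - by rewrite size_poly0.
  - by move=> u v su sv; rewrite (leq_trans (size_polyD _ _)) // geq_max su.
  - by move=> y ys; rewrite (leq_trans (size_scale_leq _ _)) ?sell.
have : p`_(size s).-1 = 0 by rewrite nth_default // -ltnS prednK // (leq_trans _ sp).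
rewrite {1}pq coef_sum => <-; rewrite /divdiff big_seq [RHS]big_seq.
apply: eq_bigr => y ys; rewrite coefZ -(sell y ys) -lead_coefE (monicP (mell y)) mulr1.
by rewrite ellE.
Qed.

Lemma divdiff_cons {R : fieldType} (x : R) (s : seq R) (phi : R -> R) : x \notin s ->
  divdiff (x :: s) phi =
    phi x / \prod_(z <- s) (x - z) + divdiff s (fun y => phi y / (y - x)).
Proof.
move=> xs; rewrite /divdiff big_cons; congr (_ + _).
  rewrite big_cons eqxx /=; congr (_ / _); rewrite big_seq_cond [RHS]big_seq.
  apply: eq_bigl => z; rewrite andbC; case: eqVneq => //= ->.
  by rewrite (negbTE xs).
rewrite big_seq [RHS]big_seq; apply: eq_bigr => y ys.
rewrite big_cons eq_sym ifT; last by apply: contraNneq xs => <-.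
by rewrite invfM mulrA.
Qed.

(** With - x as an additional node, the division by y + x is absorbed into the node products, and
    the enlarged divided difference of p vanishes by degree. *)
Lemma divdiff_div {R : fieldType} (x : R) (s : seq R) (p : {poly R}) :
  uniq s -> - x \notin s -> (size p <= size s)%N ->
  divdiff s (fun y => p.[y] / (y + x)) = - (p.[- x] / \prod_(z <- s) (- x - z)).
Proof.
move=> us xs sp; have := @divdiff_poly _ (- x :: s) p.
rewrite /= xs us ltnS sp => /(_ isT isT); rewrite divdiff_cons //.
by under [divdiff _ _]eq_bigr do rewrite opprK; move/eqP; rewrite addrC addr_eq0 => /eqP.
Qed.

Lemma divdiffD {R : fieldType} (s : seq R) (f g : R -> R) :
  divdiff s (fun y => f y + g y) = divdiff s f + divdiff s g.
Proof. by rewrite /divdiff -big_split; apply: eq_bigr => y _; rewrite mulrDl. Qed.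

Lemma divdiffZ {R : fieldType} (s : seq R) (c : R) (f : R -> R) :
  divdiff s (fun y => c * f y) = c * divdiff s f.
Proof. by rewrite /divdiff mulr_sumr; apply: eq_bigr => y _; rewrite mulrA. Qed.

Lemma eq_divdiff {R : fieldType} (s : seq R) (f g : R -> R) :
  {in s, f =1 g} -> divdiff s f = divdiff s g.
Proof. by move=> fg; rewrite /divdiff !big_seq; apply: eq_bigr => y /fg ->. Qed.

Lemma prod_opp_sub {R : comRingType} (x : R) (s : seq R) :
  \prod_(z <- s) (- x - z) = (-1) ^+ size s * \prod_(z <- s) (z + x).
Proof.
elim: s => [|z s IH]; first by rewrite !big_nil mulr1.
by rewrite !big_cons IH /= exprS; ring.
Qed.

(* t |-> t `^ alpha is a mixture of the functions t / (t + x) with x > 0, for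
   which the divided difference is explicit. *)
Lemma divdiff_powR_ge0 {R : realType} (alpha : R) (s : seq R) (g : {poly R}) k :
  0 < alpha < 1 -> uniq s -> {in s, forall y, 0 < y} ->
  size s = k.*2.+2 -> (size g <= k.*2.+1)%N ->
  (forall x, 0 < x -> 0 <= g.[- x]) ->
  0 <= divdiff s (fun y => g.[y] * y `^ alpha).
Proof.
move=> a01 us s0 ss sg g0.
pose b y := g.[y] * y `^ alpha / \prod_(z <- s | z != y) (y - z).
apply: (@kernel_sum_ge0 R (fun t => expR (alpha * t) / (1 + expR t)) s b (@ln R)).
- move=> t; have e0 : 1 + expR t != 0 by rewrite gt_eqF // addr_gt0 // expR_gt0.
  apply: cvgM; last first.
    by apply: cvgV => //; apply: cvgD; [exact: cvg_cst|exact: continuous_expR].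
  apply: continuous_comp; last exact: continuous_expR.
  by apply: cvgM; [exact: cvg_cst|exact: cvg_id].
- by move=> t; rewrite divr_gt0 ?addr_gt0 ?expR_gt0.
- exact: kernel_decay.
move=> t; pose x := expR t; have x0 : 0 < x by exact: expR_gt0.
have xs : - x \notin s by apply/negP => /s0; rewrite oppr_gt0 ltNge (ltW x0).
(* For x = exp t the kernel at t - ln y equals (x / y)^alpha y / (y + x), so the factor y^alpha of
   [b y] cancels. *)
have -> : \sum_(y <- s) b y * (expR (alpha * (t - ln y)) / (1 + expR (t - ln y))) =
    expR (alpha * t) * divdiff s (fun y => ('X * g).[y] / (y + x)).
  rewrite /divdiff mulr_sumr big_seq [RHS]big_seq; apply: eq_bigr => y /s0 y0.
  rewrite /b hornerM hornerX mulrBr !expRB lnK // -/x /powR gt_eqF //.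
  have ey := expR_gt0 (alpha * ln y).
  have -> : (1 + x / y) = (y + x) / y by field; rewrite gt_eqF.
  set c := _^-1.
  by field; rewrite !gt_eqF // addr_gt0.
rewrite mulr_ge0 ?expR_ge0 // divdiff_div //; last first.
  by apply: leq_trans (size_polyMleq _ _) _; rewrite size_polyX ss.
(* The number of nodes is even, so the product of the - x - z equals that of the z + x; the sign of
   the factor - x cancels the outer minus. *)
rewrite prod_opp_sub ss -doubleS -mul2n exprM sqrrN expr1n expr1n mul1r.
rewrite hornerM hornerX mulNr mulNr opprK divr_ge0 ?mulr_ge0 ?g0 ?(ltW x0) //.
by rewrite big_seq; apply: prodr_ge0 => z /s0 z0; rewrite addr_ge0 // ltW.
Qed.

Lemma divdiff_head {R : fieldType} (x : R) (s : seq R) (phi : R -> R) :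
  x \notin s -> {in s, forall y, phi y = 0} ->
  divdiff (x :: s) phi = phi x / \prod_(z <- s) (x - z).
Proof.
move=> xs phi0; rewrite divdiff_cons // [X in _ + X](_ : _ = 0) ?addr0 //.
by rewrite /divdiff big_seq big1 // => y ys; rewrite phi0 // !mul0r.
Qed.

(** * Lower bound for the best approximation *)

Lemma prod_subr_sign {R : realFieldType} (t : R) (s : seq R) : t \notin s ->
  0 < (-1) ^+ count (> t) s * \prod_(y <- s) (t - y).
Proof.
elim: s => [|y s IH]; first by rewrite big_nil mul1r ltr01.
rewrite in_cons negb_or => /andP[ty /IH {}IH]; rewrite big_cons /= exprD mulrACA.
rewrite mulr_gt0 //; case: (ltgtP t y) ty => // ty _ /=.
  by rewrite expr1 mulN1r opprB subr_gt0.
by rewrite expr0 mul1r subr_gt0.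
Qed.

Lemma ler_prod_subr {R : realFieldType} (t x : R) (s : seq R) :
  0 < t -> 0 < x -> {in s, forall y, 0 < y} ->
  `|\prod_(y <- s) (t - y)| * (x / t) ^+ count (< t) s <= \prod_(y <- s) (y + x).
Proof.
move=> t0 x0; elim: s => [|y s IH] s0; first by rewrite !big_nil normr1 mul1r expr0.
rewrite !big_cons /= normrM exprD mulrACA.
have y0 : 0 < y by rewrite s0 ?mem_head.
have {}IH : `|\prod_(y <- s) (t - y)| * (x / t) ^+ count (< t) s <= \prod_(y <- s) (y + x).
  by apply: IH => u us; rewrite s0 // in_cons us orbT.
have xt : 0 <= x / t by rewrite ltW // divr_gt0.
apply: ler_pM => //; rewrite ?mulr_ge0 ?exprn_ge0 //.
case: (ltP y t) => yt /=.
  rewrite expr1 gtr0_norm ?subr_gt0 // mulrBl mulrCA divff ?gt_eqF // mulr1.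
  have : 0 <= y * (x / t) by rewrite mulr_ge0 // ltW.
  by move: y0; lra.
by rewrite expr0 mulr1 ler0_norm ?subr_le0 // opprB; lra.
Qed.

(** [h] competes with Q / Q(t) in [interpolant_lower_bound]. Its degree is half the number of nodes
    below [t], which is even because the product is positive and [size s] is even. *)
Lemma test_polynomial {R : realFieldType} (t : R) (s : seq R) k :
  0 < t -> {in s, forall y, 0 < y} -> t \notin s -> size s = k.*2 ->
  0 < \prod_(y <- s) (t - y) ->
  exists h : {poly R}, [/\ (size h <= k.+1)%N, h.[t] = 1 &
    forall x, 0 < x -> \prod_(y <- s) (t - y) * h.[- x] ^+ 2 <= \prod_(y <- s) (y + x)].
Proof.
move=> t0 s0 ts ss pos; have := prod_subr_sign t s ts.
rewrite (pmulr_lgt0 _ pos) => cgt.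
have even_gt : ~~ odd (count (> t) s).
  by apply: contraTN cgt => o; rewrite -signr_odd o expr1 ltr0N1.
have cE : (count (< t) s + count (> t) s)%N = k.*2.
  rewrite -ss -(count_predC (< t) s); congr addn; apply: eq_in_count => y ys /=.
  by case: (ltgtP y t) => // yt; rewrite -yt ys in ts.
pose m := (count (< t) s)./2.
have cm : count (< t) s = m.*2.
  rewrite -[LHS]odd_double_half; move: cE even_gt => /(congr1 odd).
  by rewrite oddD odd_double; case: (odd (count (< t) s)); case: (odd _).
have mk : (m <= k)%N by rewrite -leq_double -cm -cE leq_addr.
(* For y < t the factor t - y of the product needs a factor x / t, because
   (t - y) (x / t) <= x <= y + x; for y > t it is dominated by y + x as it is. *)
exists (t^-1 ^+ m *: 'X^m); split.
- by rewrite (leq_trans (size_scale_leq _ _)) // size_polyXn.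
- by rewrite hornerZ hornerXn -exprMn mulVf ?expr1n // gt_eqF.
move=> x x0; apply: le_trans (ler_prod_subr t x s t0 x0 s0).
rewrite (gtr0_norm pos) ler_wpM2l ?(ltW pos) // hornerZ hornerXn -exprMn.
by rewrite -exprM mulnC exprM mulrN sqrrN -exprM mul2n -cm mulrC.
Qed.

Lemma interpolant_lower_bound {R : realType} (alpha : R) (P Q : {poly R})
    (x1 : R) (z : seq R) k (t : R) :
  0 < alpha < 1 -> (size P <= k.+1)%N -> (size Q <= k.+1)%N ->
  uniq (x1 :: z) -> size z = k.*2 ->
  {in x1 :: z, forall y, 0 < y /\ P.[y] = y `^ alpha * Q.[y]} ->
  {in z, forall y, x1 < y} ->
  0 < t -> Q.[t] != 0 -> P.[t] / Q.[t] < t `^ alpha ->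
  x1 < t /\ x1 `^ alpha <= P.[t] / Q.[t].
Proof.
move=> a01 sP sQ us sz z0 x1z t0 Qt rt.
have ts : t \notin x1 :: z.
  by apply/negP => /z0[_ Pt]; move: rt; rewrite Pt mulfK ?ltxx.
pose q : {poly R} := Q.[t]^-1 *: Q; pose p : {poly R} := Q.[t]^-1 *: P; pose r := P.[t] / Q.[t].
have sq : (size q <= k.+1)%N by rewrite (leq_trans (size_scale_leq _ _)).
have sp : (size p <= k.+1)%N by rewrite (leq_trans (size_scale_leq _ _)).
have qt : q.[t] = 1 by rewrite hornerZ mulVf.
have pt : p.[t] = r by rewrite hornerZ mulrC.
pose D (g : {poly R}) := divdiff (t :: x1 :: z) (fun y => g.[y] * y `^ alpha).
pose W := \prod_(y <- x1 :: z) (t - y).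
have W0 : W != 0.
  rewrite prodf_seq_neq0; apply/allP => y ys; rewrite subr_eq0 /=.
  by apply: contraNneq ts => ->.
have uts : uniq (t :: x1 :: z) by rewrite cons_uniq ts.
have D_D g h : D (g + h) = D g + D h.
  by rewrite -divdiffD; apply: eq_divdiff => y _; rewrite hornerD mulrDl.
have D_Z c g : D (c *: g) = c * D g.
  by rewrite -divdiffZ; apply: eq_divdiff => y _; rewrite hornerZ mulrA.
have D_ge0 (g : {poly R}) : (size g <= k.*2.+1)%N -> (forall x, 0 < x -> 0 <= g.[- x]) -> 0 <= D g.
  move=> sg g0; apply: (divdiff_powR_ge0 _ _ _ k) => //; last by rewrite /= sz.
  by move=> y; rewrite in_cons => /predU1P[->//|/z0[]].
have size_sqr (g h : {poly R}) : (size g <= k.+1)%N -> (size h <= k.+1)%N ->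
    (size (g * h)%R <= k.*2.+1)%N.
  move=> sg sh; apply: leq_trans (size_polyMleq _ _) _.
  by move: (size g) (size h) sg sh => a b; clear; lia.
(* The error function q * y^alpha - p vanishes at the nodes. *)
have D_orth (u : {poly R}) : (size u <= k.+1)%N -> D (q * u) = u.[t] * (t `^ alpha - r) / W.
  move=> su; pose err y := (q.[y] * y `^ alpha - p.[y]) * u.[y].
  have -> : D (q * u) = divdiff (t :: x1 :: z) (horner (p * u)) + divdiff (t :: x1 :: z) err.
    rewrite -divdiffD; apply: eq_divdiff => y _; rewrite /err !hornerM; ring.
  rewrite divdiff_poly ?add0r //; last by rewrite /= sz ltnS size_sqr.
  rewrite divdiff_head // => [|y ys]; first by rewrite /err qt pt mul1r (mulrC u.[t]).
  rewrite /err; have [_ Py] := z0 y ys.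
  by rewrite /p /q !hornerZ Py; ring.
(* Nonnegativity for the square of [q] forces W > 0, as t^alpha > r; left of [x1] all 2 k + 1
   factors of W would be negative. *)
have rWt : 0 <= (t `^ alpha - r) / W.
  have := D_orth q sq; rewrite qt mul1r => <-; apply: D_ge0; first exact: size_sqr.
  by move=> x _; rewrite hornerM -expr2 sqr_ge0.
have Wpos : 0 < W.
  rewrite lt_neqAle eq_sym W0 /= leNgt; apply/negP => Wn; move: rWt.
  have Wi : W^-1 < 0 by rewrite invr_lt0.
  by rewrite leNgt (nmulr_llt0 _ Wi) subr_gt0 rt.
have x1t : x1 < t.
  rewrite ltNge; apply/negP => tx1.
  have tlt y : y \in x1 :: z -> t < y.
    move=> ys; have /negP := ts; rewrite lt_neqAle => h; apply/andP; split.
      by apply/eqP => ty; apply: h; rewrite ty.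
    by move: ys; rewrite in_cons => /predU1P[->//|/x1z/ltW]; exact: le_trans.
  have := signr_prod_subl t (x1 :: z) tlt; rewrite -/W /= sz -signr_odd /= odd_double.
  by rewrite expr1 mulN1r oppr_gt0 ltNge (ltW Wpos).
split=> //.
have tz : t \notin z by move: ts; rewrite in_cons negb_or => /andP[].
have zpos : {in z, forall y, 0 < y}.
  by move=> y yz; have [] := z0 y; rewrite // in_cons yz orbT.
have [_ x1nz] : (x1 \in x1 :: z) /\ x1 \notin z by move: us; rewrite mem_head /= => /andP[].
have x10 : 0 < x1 by have [] := z0 x1 (mem_head _ _).
pose W' := \prod_(y <- z) (t - y).
have WE : W = (t - x1) * W' by rewrite /W big_cons.
have W'pos : 0 < W' by move: Wpos; rewrite WE pmulr_rgt0 // subr_gt0.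
have [h [sh ht Hh]] := test_polynomial t z k t0 zpos tz sz W'pos.
(* As h(t) = q(t) = 1, [D_orth] gives D (q h) = D (q q), so that D ((h - q)^2) = D (h^2) - D
   (q^2). *)
have h2 : (t `^ alpha - r) / W <= D (h * h).
  have : 0 <= D ((h - q) * (h - q)).
    apply: D_ge0 => [|x _]; last by rewrite hornerM -expr2 sqr_ge0.
    by apply: size_sqr; rewrite (leq_trans (size_polyD _ _)) // geq_max size_polyN sh.
  have -> : (h - q) * (h - q) = h * h + (-2 *: (q * h) + q * q).
    by rewrite -mul_polyC; ring.
  rewrite !D_D D_Z !D_orth // ht qt; lra.
(* [g0] vanishes on [z], so only the nodes [t] and [x1] contribute to D g0. At - x it is (t - x1)
   times the product of the y + x, which dominates W h^2 by the choice of [h]. *)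
pose g0 : {poly R} := (t - x1) *: \prod_(y <- z) (y%:P - 'X).
have g0E y : g0.[y] = (t - x1) * \prod_(u <- z) (u - y).
  rewrite hornerZ horner_prod; congr (_ * _); apply: eq_bigr => u _.
  by rewrite hornerD hornerN hornerC hornerX.
have prod_flip y : \prod_(u <- z) (u - y) = \prod_(u <- z) (y - u).
  have := prod_opp_sub (- y) z; rewrite sz -signr_odd odd_double expr0 mul1r => <-.
  by apply: eq_bigr => u _; rewrite opprK.
have Dg0 : D g0 = t `^ alpha - x1 `^ alpha.
  rewrite /D divdiff_cons // divdiff_head //; last first.
    by move=> y yz; rewrite g0E (big_rem y yz) /= subrr mul0r mulr0 !mul0r.
  rewrite -/W !g0E !prod_flip -/W' -WE.
  have W'1 : \prod_(u <- z) (x1 - u) != 0.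
    rewrite prodf_seq_neq0; apply/allP => y yz; rewrite subr_eq0 /=.
    by apply: contraNneq x1nz => ->.
  rewrite WE; field; rewrite W'1 !subr_eq0 (lt_eqF x1t) (gt_eqF x1t) /=.
  by rewrite gt_eqF.
have : 0 <= D (g0 + (- W) *: (h * h)).
  apply: D_ge0.
    rewrite (leq_trans (size_polyD _ _)) // geq_max; apply/andP; split.
      rewrite (leq_trans (size_scale_leq _ _)) // -sz.
      elim: (z) => [|u v IH]; first by rewrite big_nil size_poly1.
      rewrite big_cons (leq_trans (size_polyMleq _ _)) //.
      have -> : u%:P - 'X = - ('X - u%:P) by rewrite opprB.
      by rewrite size_polyN size_XsubC.
    by rewrite (leq_trans (size_scale_leq _ _)) // size_sqr.
  move=> x x0; rewrite hornerD g0E hornerZ hornerM -expr2 WE mulNr -mulrA -mulrBr.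
  rewrite mulr_ge0 // ?subr_ge0 ?(ltW x1t) //.
  under eq_bigr do rewrite opprK; exact: Hh.
rewrite D_D Dg0 D_Z mulNr subr_ge0 => h3.
(* Together, t^alpha - r <= W D (h^2) <= t^alpha - x1^alpha. *)
have h4 : t `^ alpha - r <= W * D (h * h) by rewrite mulrC -ler_pdivrMr.
move: h3 h4; rewrite /r; lra.
Qed.

Lemma best_ratapprox_lower_bound {R : realType} (k : nat) (alpha : R) (r : R -> R)
    (xi m t : R) :
  0 < alpha < 1 -> best_ratapprox k alpha r ->
  smallest_root (fun t => r t - t `^ alpha) xi ->
  0 < m -> m <= xi -> m <= t -> m `^ alpha <= r t.
Proof.
move=> a01 bestr [_ _ xi_min] m0 mxi mt; have /andP[a0 _] := a01.
have [P [Q [z [[sP sQ mQ rE] [uz sz z0]]]]] := best_ratapprox_zeros k alpha r a01 bestr.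
have Qn0 : Q != 0 by rewrite monic_neq0.
have [|||_ PQ QP] := poly_powR_alternate P Q alpha k z a01 sP sQ _ uz.
- by rewrite Qn0 orbT.
- by move=> y /z0[/andP[]].
- by rewrite sz.
(* Since P_k Q_k > 0, the degree of Q is exactly k and its leading coefficient is 1. Positivity then
   descends from Q_(k-j) to P_(k-j) and on to Q_(k-j-1). *)
have Qk : 0 < Q`_k.
  have Qk0 : Q`_k != 0.
    by apply/eqP => Qk; have := PQ k (leqnn k); rewrite Qk mulr0 ltxx.
  have sQk : size Q = k.+1.
    by apply/eqP; rewrite eqn_leq sQ ltnNge; apply: contra Qk0 => h; rewrite nth_default.
  by have /monicP := mQ; rewrite lead_coefE sQk /= => ->; exact: ltr01.
have Qi j : (j <= k)%N -> 0 < Q`_(k - j).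
  elim: j => [|j IH] jk; first by rewrite subn0.
  have jk' : (j < k)%N by [].
  have E : (k - j.+1).+1 = (k - j)%N by rewrite -subSn // subSS.
  have lt : (k - j.+1 < k)%N by rewrite ltn_subrL (leq_ltn_trans _ jk').
  have := PQ (k - j)%N (leq_subr _ _); rewrite (pmulr_lgt0 _ (IH (ltnW jk'))) => Pp.
  by have := QP _ lt; rewrite E pmulr_lgt0.
have Qpos y : 0 < y -> 0 < Q.[y].
  move=> y0; rewrite (horner_coef_wide _ sQ) big_ord_recr /= ltr_wpDl ?mulr_gt0 ?exprn_gt0 //.
  apply: sumr_ge0 => i _; rewrite mulr_ge0 ?exprn_ge0 ?(ltW y0) //.
  by rewrite ltW // -(subKn (ltnW (ltn_ord i))) Qi // leq_subr.
have t0 : 0 < t by apply: lt_le_trans mt.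
have powR_le x y : 0 < x -> x <= y -> x `^ alpha <= y `^ alpha.
  move=> x0 xy; rewrite ge0_ler_powR // ?nnegrE ?(ltW a0) ?(ltW x0) //.
  by rewrite (le_trans (ltW x0)).
have [rt|rt] := leP (t `^ alpha) (r t); first by rewrite (le_trans _ rt) ?powR_le.
have ssz : size (sort <=%R z) = k.*2.+1 by rewrite size_sort.
have : sorted <%R (sort <=%R z) by rewrite lt_sorted_uniq_le sort_uniq uz sort_le_sorted.
have mz : {in sort <=%R z, forall y, 0 < y < 1 /\ P.[y] = y `^ alpha * Q.[y]}.
  by move=> y; rewrite mem_sort => /z0.
have := sort_uniq <=%R z; rewrite uz.
move: ssz mz; case: (sort _ z) => // x1 w [sw] mz uw /[dup] _.
rewrite /= lt_path_sortedE => /andP[/allP x1w _].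
have [x101 x1E] := mz x1 (mem_head _ _); have /andP[x10 _] := x101.
have [|||_ h] := interpolant_lower_bound alpha P Q x1 w k t a01 sP sQ uw sw _ x1w t0.
- by move=> y /mz[/andP[]].
- by rewrite gt_eqF ?Qpos.
- by move: rt; rewrite rE.
(* [x1] is a root of the error function in ]0, 1[, since Q does not vanish there. *)
have xix1 : xi <= x1.
  by apply: xi_min => //; rewrite rE x1E mulfK ?subrr // gt_eqF ?Qpos.
by rewrite rE (le_trans _ h) ?powR_le // (le_trans mxi).
Qed.

(** * Functions of symmetric matrices *)

Lemma norm2_orthogonal {R : realType} (N : nat) (P : 'M[R]_N) (v : 'cV[R]_N) :
  P *m P^T = 1%:M -> norm2 (P^T *m v) = norm2 v.
Proof.
move=> PP; have norm2E (w : 'cV[R]_N) : norm2 w = Num.sqrt ((w^T *m w) 0 0).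
  by rewrite /norm2 mxE; congr Num.sqrt; apply: eq_bigr => i _; rewrite mxE expr2.
by rewrite !norm2E trmx_mul trmxK mulmxA -(mulmxA _ P) PP mulmx1.
Qed.

Lemma norm2_diag_le {R : realType} (N : nat) (d : 'rV[R]_N) (v : 'cV[R]_N) (M : R) :
  0 <= M -> (forall i, `|d 0 i| <= M) -> norm2 (diag_mx d *m v) <= M * norm2 v.
Proof.
move=> M0 dM.
have -> : M = Num.sqrt (M ^+ 2) by rewrite sqrtr_sqr ger0_norm.
rewrite /norm2 -sqrtrM ?sqr_ge0 // ler_wsqrtr // mulr_sumr ler_sum // => i _.
rewrite mul_diag_mx mxE exprMn ler_wpM2r ?sqr_ge0 //.
by rewrite -(real_normK (num_real _)) lerXn2r // nnegrE.
Qed.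

Lemma mxfun_spectral_norm_le {R : realType} (N : nat) (P : 'M[R]_N) (d : 'rV[R]_N)
   (v : 'cV[R]_N) (M : R) : P *m P^T = 1%:M ->
  0 <= M -> (forall i, `|d 0 i| <= M) -> norm2 (P^T *m diag_mx d *m P *m v) <= M * norm2 v.
Proof.
move=> PP M0 dM; rewrite -!mulmxA norm2_orthogonal //.
have -> : norm2 v = norm2 (P *m v).
  by rewrite -[in RHS](trmxK P) norm2_orthogonal // trmxK; exact: mulmx1C.
exact: norm2_diag_le.
Qed.

Lemma mxfun_undef {R : realType} (N : nat) (f : R -> R) (A : 'M[R]_N) :
  ~ (exists P d, spectral_decomp A P d) -> mxfun f A = 0.
Proof. by move=> H; apply: xgetPN => B [P [d [HPd _]]]; apply: H; exists P, d. Qed.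

Lemma spectral_decompZ {R : realType} (N : nat) (c : R) (A P : 'M[R]_N) (d : 'rV[R]_N) :
  spectral_decomp A P d -> spectral_decomp (c *: A) P (c *: d).
Proof.
move=> [PP ->]; split=> //.
by rewrite linearZ /= -scalemxAr -scalemxAl.
Qed.

Lemma invmx_orthogonal_diag {R : realType} (N : nat) (P : 'M[R]_N) (d : 'rV[R]_N) :
  P *m P^T = 1%:M -> (forall i, d 0 i != 0) ->
  invmx (P^T *m diag_mx d *m P) = P^T *m diag_mx (map_mx (@GRing.inv R) d) *m P.
Proof.
move=> PP d0; have PP' : P^T *m P = 1%:M by exact: mulmx1C.
have BB : P^T *m diag_mx (map_mx (@GRing.inv R) d) *m P *m (P^T *m diag_mx d *m P) = 1%:M.
  rewrite -!mulmxA (mulmxA P P^T) PP mul1mx (mulmxA (diag_mx _) (diag_mx _)) mulmx_diag.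
  suff -> : \row_j (map_mx (@GRing.inv R) d 0 j * d 0 j) = const_mx 1.
    by rewrite diag_const_mx mul1mx.
  by apply/rowP => j; rewrite !mxE mulVf.
have [_ uB] := mulmx1_unit BB.
by rewrite -[LHS]mul1mx -BB mulmxK.
Qed.

(** [invmx] returns a singular matrix unchanged; in dimension 0 there are no entries to compare. *)
Lemma invmx0 {R : comUnitRingType} (N : nat) : invmx (0 : 'M[R]_N) = 0.
Proof.
case: N => [|N]; first by apply/matrixP => -[].
by rewrite /invmx unitmxE det0 unitr0.
Qed.

Lemma sym_posdef_eigenvalue_gt0 {R : realType} (N : nat) (A : 'M[R]_N) (a : R) :
  sym_posdef A -> eigenvalue A a -> 0 < a.
Proof.
move=> [_ pd] /eigenvalueP[v vA v0].
have := pd v^T; rewrite trmxK vA -scalemxAl mxE.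
have v2 : 0 <= (v *m v^T) 0 0 by rewrite mxE sumr_ge0 // => i _; rewrite mxE -expr2 sqr_ge0.
have vT : v^T != 0 by apply: contra v0 => /eqP vT; rewrite -[v]trmxK vT trmx0.
move=> /(_ vT) h; rewrite ltNge; apply/negP => a0.
by move: h; rewrite ltNge mulr_le0_ge0.
Qed.

Lemma spectral_decomp_eigenvalue {R : realType} (N : nat) (A P : 'M[R]_N) (d : 'rV[R]_N) i :
  spectral_decomp A P d -> eigenvalue A (d 0 i).
Proof.
move=> [PP ->]; apply/eigenvalueP; exists (row i P).
  rewrite -row_mul !mulmxA PP mul1mx mul_diag_mx.
  by apply/rowP => j; rewrite !mxE.
apply/eqP => P0; have : row i (P *m P^T) = 0 by rewrite row_mul P0 mul0mx.
by rewrite PP => /rowP/(_ i)/eqP; rewrite !mxE eqxx oner_eq0.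
Qed.

Lemma ordered_spectrum_ge {R : realType} (N : nat) (A : 'M[R]_N) (lam : N.-tuple R) (a : R) :
  ordered_spectrum A lam -> eigenvalue A a -> lam`_0 <= a.
Proof.
move=> [slam cp]; rewrite eigenvalue_root_char cp root_prod_XsubC => alam.
case: (tval lam) slam alam => //= x s; rewrite le_path_sortedE => /andP[/allP h _].
by rewrite in_cons => /predU1P[->//|/h].
Qed.

Lemma ordered_spectrum_head {R : realType} (N : nat) (A : 'M[R]_N) (lam : N.-tuple R) :
  (0 < N)%N -> ordered_spectrum A lam -> eigenvalue A lam`_0.
Proof.
move=> N0 [_ cp]; rewrite eigenvalue_root_char cp root_prod_XsubC.
by apply: mem_nth; rewrite size_tuple.
Qed.

(** The entry A_00 is the quadratic form at the first basis vector, so the first row sum is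
    positive. *)
Lemma mx_norm_inf_gt0 {R : realType} (N : nat) (A : 'M[R]_N) :
  (0 < N)%N -> sym_posdef A -> 0 < mx_norm_inf A.
Proof.
case: N A => // N A _ [_ pd].
have A00 : A 0 0 != 0.
  have v0 : (delta_mx 0 0 : 'cV[R]_N.+1) != 0.
    by apply/eqP => /matrixP/(_ 0 0)/eqP; rewrite !mxE !eqxx oner_eq0.
  have := pd _ v0; rewrite trmx_delta -rowE -colE !mxE.
  by move/lt0r_neq0.
apply: (@lt_le_trans _ _ (\sum_(j < N.+1) `|A 0 j|)).
  by rewrite (bigD1 0) //= ltr_pwDl ?normr_gt0 // sumr_ge0.
exact: (le_bigmax _ (fun i : 'I_N.+1 => \sum_(j < N.+1) `|A i j|) 0).
Qed.

(** * The norm bound *)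

Theorem mainTheorem3 (R : realType) (N : nat) (A : 'M[R]_N)
    (lam : N.-tuple R) (alpha : R) (k : nat) (f : 'cV[R]_N)
    (r : R -> R) (xi1 : R) :
  sym_posdef A ->
  ordered_spectrum A lam ->
  0 < alpha < 1 ->
  (0 < k)%N ->
  f != 0 ->
  best_ratapprox k alpha r ->
  smallest_root (fun t => r t - t `^ alpha) xi1 ->
  let Lambda := mx_norm_inf A in
  let calA := Lambda^-1 *: A in
  let lambda1 := lam`_0 in
  let mu1 := Lambda^-1 * lambda1 in
  let u := mxfun (fun x => x `^ (- alpha)) A *m f in
  let ur := Lambda `^ (- alpha) *: (invmx (mxfun r calA) *m f) in
  0 <= mu1 <= xi1 ->
  norm2 (ur - u) / norm2 f <= lambda1 `^ (- alpha).
Proof.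
move=> pdA specA a01 _ f0 bestr rootr Lambda calA lambda1 mu1 u ur /andP[_ mu1xi].
have N0 : (0 < N)%N.
  by case: N f f0 {A lam pdA specA Lambda calA lambda1 mu1 u ur mu1xi} => // f; rewrite flatmx0 eqxx.
have Lam0 : 0 < Lambda by exact: mx_norm_inf_gt0.
have lam0 : 0 < lambda1.
  by apply: sym_posdef_eigenvalue_gt0 pdA _; exact: ordered_spectrum_head.
have mu0 : 0 < mu1 by rewrite mulr_gt0 ?invr_gt0.
have nf : 0 < norm2 f.
  rewrite sqrtr_gt0 lt_neqAle sumr_ge0 ?andbT => [|i _]; last exact: sqr_ge0.
  apply: contra f0; rewrite eq_sym psumr_eq0 => [/allP fi0|i _]; last exact: sqr_ge0.
  apply/eqP/colP => i; rewrite mxE; apply/eqP; rewrite -sqrf_eq0.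
  by apply: fi0; rewrite mem_index_enum.
rewrite ler_pdivrMr //.
(* If A had no spectral decomposition, mxfun would return its default value 0
   for A and for calA, and the bound would be trivial. *)
have [[P [d spec]]|nospec] := pselect (exists P d, spectral_decomp A P d); last first.
  have nospec' : ~ exists P d, spectral_decomp calA P d.
    move=> [P [d /(spectral_decompZ _ Lambda)]].
    rewrite scalerA divff ?gt_eqF // scale1r => spec.
    by apply: nospec; exists P, (Lambda *: d).
  rewrite /ur /u !mxfun_undef // invmx0 !mul0mx scaler0 subr0.
  rewrite [norm2 0]/norm2 big1 => [|i _]; last by rewrite mxE expr0n.
  by rewrite sqrtr0 mulr_ge0 ?powR_ge0 // ltW.
have PP : P *m P^T = 1%:M by case: spec.
have dlam i : lambda1 <= d 0 i.
  exact: ordered_spectrum_ge specA (spectral_decomp_eigenvalue _ _ _ _ _ spec).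
pose mu i := Lambda^-1 * d 0 i.
have mu1mu i : mu1 <= mu i by rewrite ler_pM2l ?invr_gt0.
have rmu i : mu1 `^ alpha <= r (mu i) by apply: (best_ratapprox_lower_bound k alpha r xi1).
have rmu0 i : 0 < r (mu i) by apply: lt_le_trans (rmu i); exact: powR_gt0.
have specC := spectral_decompZ _ Lambda^-1 _ _ _ spec.
(* A and [calA] share the eigenbasis P, in which the error operator is diagonal with these
   entries. *)
pose e : 'rV[R]_N := \row_i (Lambda `^ (- alpha) * (r (mu i))^-1 - d 0 i `^ (- alpha)).
have -> : ur - u = P^T *m diag_mx e *m P *m f.
  rewrite /ur /u (mxfunE _ spec) (mxfunE _ specC) invmx_orthogonal_diag //; last first.
    by move=> i; rewrite !mxE gt_eqF ?rmu0.
  rewrite scalemxAl -mulmxBl scalemxAl -mulmxBl scalemxAr -mulmxBr; congr (_ *m _ *m _ *m _).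
  apply/matrixP => i j; rewrite !mxE.
  by case: (i == j); rewrite ?mulr1n // !mulr0n mulr0 subrr.
apply: mxfun_spectral_norm_le => // [|i]; first exact: powR_ge0.
rewrite mxE.
have d0 : 0 < d 0 i by apply: lt_le_trans (dlam i).
have /andP[a0 _] := a01.
have h1 : d 0 i `^ (- alpha) <= lambda1 `^ (- alpha).
  rewrite !powRN lef_pV2 ?posrE ?powR_gt0 //.
  by rewrite ge0_ler_powR ?nnegrE ?(ltW a0) ?(ltW lam0) ?(ltW d0) ?dlam.
have h2 : Lambda `^ (- alpha) * (r (mu i))^-1 <= lambda1 `^ (- alpha).
  have -> : lambda1 = Lambda * mu1 by rewrite mulrA divff ?mul1r // gt_eqF.
  rewrite powRM ?(ltW Lam0) ?(ltW mu0) // ler_wpM2l ?powR_ge0 //.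
  by rewrite powRN lef_pV2 ?posrE ?powR_gt0.
have h3 : 0 <= Lambda `^ (- alpha) * (r (mu i))^-1.
  by rewrite mulr_ge0 ?powR_ge0 // invr_ge0 ltW.
have h4 := powR_ge0 (d 0 i) (- alpha).
by rewrite ler_norml; apply/andP; split; move: h1 h2 h3 h4; lra.
Qed.
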